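(* There exists a non-empty Zariski open subset $\Delta\subset\mathbb C^2$ (coordinates $(d,k)$) such that for every $(d_0,k_0)\in\Delta$: (1) there exist exactly $\delta_1$ solutions $\Gamma=\{(p_i,q_i,u_i)\}_{i=1,\dots,\delta_1}$ (with $p_i,q_i\in\mathbb C^2$, $u_i\in\mathbb C$) of the system $\mathfrak S_2(d_0,k_0)$ such that (a) $q_1,\dots,q_{\delta_1}$ are pairwise distinct and $\mathcal L(k_0)\cap\mathcal O_{d_0}(\mathcal C)=\{q_1,\dots,q_{\delta_1}\}$, and (b) $p_1,\dots,p_{\delta_1}$ are pairwise distinct regular non-ramification points of $\mathcal C$; (2) no point of $\mathcal C$ lying on the line $y_2=k_0$ is a ramification point of $\mathcal C$.
   Context: Standing assumptions and notation. $f(y_1,y_2)\in\mathbb C[y_1,y_2]$ is an irreducible polynomial of degree $n$ defining an affine plane curve $\mathcal C\subset\mathbb C^2$; $\mathcal C$ is not a line, and $f$ does not divide $f_1^2+f_2^2$, where $f_i=\partial f/\partial y_i$. Write $\bar y=(y_1,y_2)$, $\bar x=(x_1,x_2)$, and let $d,u$ be further variables. Put $b(\bar y,\bar x,d)=(x_1-y_1)^2+(x_2-y_2)^2-d^2$, $n(\bar y,\bar x)=-f_2(\bar y)(x_1-y_1)+f_1(\bar y)(x_2-y_2)$, $w(\bar y,u)=u(f_1^2(\bar y)+f_2^2(\bar y))-1$. Let $\Omega(d)\subset\mathbb C^6$ be the common zero set of $f,b,n,w$ in the variables $(\bar y,\bar x,d,u)$, and for $d_0\in\mathbb C\setminus\{0\}$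 let $I(d_0)=\langle f,b(\bar y,\bar x,d_0),n,w\rangle\subset\mathbb C[\bar y,\bar x,u]$ and $\Omega(d_0)\subset\mathbb C^5$ its zero set. The offset of $\mathcal C$ at distance $d_0$ is $\mathcal O_{d_0}(\mathcal C)$, the Zariski closure of the projection of $\Omega(d_0)$ to the $\bar x$-coordinates; the generic offset $\mathcal O_d(\mathcal C)\subset\mathbb C^3$ is the Zariski closure of the projection of $\Omega(d)$ to the $(\bar x,d)$-coordinates (it is a surface). The generic offset equation $g(x_1,x_2,d)\in\mathbb C[\bar x,d]$ is a square-free polynomial defining the surface $\mathcal O_d(\mathcal C)$, normalized to have no factor of positive degree lying in $\mathbb C[d]$ (it is determined up to a nonzero constant factor). Let $\delta_1=\deg_{x_1}g$. For $(d_0,k_0)\in\mathbb C^2$, $\mathcal L(k_0)$ is the line $x_2=k_0$, and $\mathfrak S_2(d_0,k_0)$ is the system $f(\bar y)=0$, $b(\bar y,\bar x,d_0)=0$, $n(\bar y,\bar x)=0$, $w(\bar y,u)=0$, $x_2-k_0=0$ in the unknowns $(\bar y,\bar x,u)\in\mathbb C^5$. A point $p\in\mathcal C$ is a ramification point if $f_2(p)=0$; it is regular if it is a nonsingular point of $\mathcal C$. *)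

(* Defs.v *)
From mathcomp Require Import all_boot all_algebra.
From mathcomp Require Import mpoly.
From mathcomp.real_closed Require Import complex.
From mathcomp Require Import Rstruct.

Set Implicit Arguments.
Unset Strict Implicit.
Unset Printing Implicit Defensive.
Import GRing.Theory.
Local Open Scope ring_scope.

Definition CC : Type := complex Rdefinitions.R.

Definition i2_1 : 'I_2 := @Ordinal 2 1 isT.
Definition i3_1 : 'I_3 := @Ordinal 3 1 isT.
Definition i3_2 : 'I_3 := @Ordinal 3 2 isT.

Definition pt2 (a b : CC) : 'I_2 -> CC := fun i => if val i == 0%N then a else b.

Definition ev (h : {mpoly CC[2]}) (y : CC * CC) : CC := h.@[pt2 y.1 y.2].

Definition fd1 (f : {mpoly CC[2]}) : {mpoly CC[2]} := f^`M(ord0).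
Definition fd2 (f : {mpoly CC[2]}) : {mpoly CC[2]} := f^`M(i2_1).

Definition bval (y x : CC * CC) (d : CC) : CC :=
  (x.1 - y.1) ^+ 2 + (x.2 - y.2) ^+ 2 - d ^+ 2.
Definition nval (f : {mpoly CC[2]}) (y x : CC * CC) : CC :=
  - ev (fd2 f) y * (x.1 - y.1) + ev (fd1 f) y * (x.2 - y.2).
Definition wval (f : {mpoly CC[2]}) (y : CC * CC) (u : CC) : CC :=
  u * (ev (fd1 f) y ^+ 2 + ev (fd2 f) y ^+ 2) - 1.

Definition in_Omega (f : {mpoly CC[2]}) (y x : CC * CC) (d u : CC) : Prop :=
  [/\ ev f y = 0, bval y x d = 0, nval f y x = 0 & wval f y u = 0].

Definition S2sol (f : {mpoly CC[2]}) (d0 k0 : CC) (y x : CC * CC) (u : CC) : Prop :=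
  in_Omega f y x d0 u /\ x.2 - k0 = 0.

Definition zariski_closure (n : nat) (S : ('I_n -> CC) -> Prop) (z : 'I_n -> CC) : Prop :=
  forall h : {mpoly CC[n]}, (forall s, S s -> h.@[s] = 0) -> h.@[z] = 0.

Definition offset (f : {mpoly CC[2]}) (d0 : CC) (x : CC * CC) : Prop :=
  zariski_closure (fun z : 'I_2 -> CC =>
      exists (y : CC * CC) (u : CC), in_Omega f y (z ord0, z i2_1) d0 u)
    (pt2 x.1 x.2).

Definition generic_offset (f : {mpoly CC[2]}) (z : 'I_3 -> CC) : Prop :=
  zariski_closure (fun s : 'I_3 -> CC =>
      exists (y : CC * CC) (u : CC), in_Omega f y (s ord0, s i3_1) (s i3_2) u) z.

Definition mconstant (n : nat) (h : {mpoly CC[n]}) : Prop := exists c : CC, h = c%:MP.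

Definition mirreducible (n : nat) (h : {mpoly CC[n]}) : Prop :=
  ~ mconstant h /\ forall a b : {mpoly CC[n]}, h = a * b -> mconstant a \/ mconstant b.

Definition msquarefree (n : nat) (g : {mpoly CC[n]}) : Prop :=
  forall h q : {mpoly CC[n]}, g = h * h * q -> mconstant h.

Definition in_Cd (h : {mpoly CC[3]}) : Prop :=
  forall m, m \in msupp h -> m ord0 = 0%N /\ m i3_1 = 0%N.

Definition no_Cd_factor (g : {mpoly CC[3]}) : Prop :=
  forall h q : {mpoly CC[3]}, g = h * q -> in_Cd h -> mconstant h.

Definition generic_offset_equation (f : {mpoly CC[2]}) (g : {mpoly CC[3]}) : Prop :=
  [/\ forall z, g.@[z] = 0 <-> generic_offset f z, msquarefree g & no_Cd_factor g].

Definition deg_x1 (g : {mpoly CC[3]}) : nat := \max_(m <- msupp g) m ord0.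

Definition not_a_line (f : {mpoly CC[2]}) : Prop :=
  ~ exists a b c : CC, (a, b) != (0, 0) /\
      forall y : CC * CC, ev f y = 0 <-> a * y.1 + b * y.2 + c = 0.

Definition f_divides_f1f2 (f : {mpoly CC[2]}) : Prop :=
  exists q : {mpoly CC[2]}, fd1 f ^+ 2 + fd2 f ^+ 2 = f * q.

Definition regular_point (f : {mpoly CC[2]}) (p : CC * CC) : Prop :=
  ev f p = 0 /\ ~ (ev (fd1 f) p = 0 /\ ev (fd2 f) p = 0).
Definition ramification_point (f : {mpoly CC[2]}) (p : CC * CC) : Prop :=
  ev f p = 0 /\ ev (fd2 f) p = 0.

Definition zariski_open2 (U : CC * CC -> Prop) : Prop :=
  exists F : {mpoly CC[2]} -> Prop,
    forall dk, U dk <-> exists h, F h /\ ev h dk <> 0.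

(* Main.v *)
Require Import Defs.
From mathcomp Require Import all_boot all_algebra.
From mathcomp Require Import separable.
From mathcomp Require Import mpoly.
From mathcomp.real_closed Require Import complex.
From mathcomp Require Import Rstruct.
From mathcomp Require Import ring.
From Stdlib Require Import Classical.
Set Implicit Arguments.
Unset Strict Implicit.
Unset Printing Implicit Defensive.
Import GRing.Theory.
Local Open Scope ring_scope.

(** Write v = x - y for the normal vector of an offset pair, t = (-f2, f1) for
    the tangent, and g for the generic offset equation.

    Since g vanishes on all pairs (y + l grad f, l delta) with
    delta^2 = |grad f|^2, differentiating along l and along the curve gives, at
    every offset pair with d <> 0, the identity (dg/dd) v = - d (grad_x g).
    Hence, wherever dg/dd <> 0, the point y is the rational function
    x + d (grad_x g) / (dg/dd) of (x, d), and the projection of the offset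
    pairs to the (x, d)-space is injective over the simple roots of g.
    Polynomial relations between y, x and d extend from the offset pairs to
    their closure g = 0 through this formula, so a point of g = 0 comes from an
    offset pair as soon as dg/dd and the norm of grad f at that y do not vanish;
    this is shown to be coprime to g with respect to x1.  For (d, k) outside the
    zeros of the leading coefficient of g, of the Bezout constant of g and its
    x1-derivative, and of the Bezout constant of that coprimality, the roots of
    g(., k, d) are simple, deg_x1 g in number, and correspond to the solutions of
    the system.  A solution with f2(y) = 0 would have y2 = k, which is excluded
    for all but finitely many k. *)

(** * Gauss's lemma *)

Definition divides (R : idomainType) (a b : R) := exists c, b = a * c.

Definition prime_elt (R : idomainType) (p : R) :=
  [/\ p != 0, p \isn't a GRing.unit &
      forall a b, divides p (a * b) -> divides p a \/ divides p b].

(** The factors are prime, not merely irreducible, so that later inductions can distribute each of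
    them by divisibility alone. *)
Inductive factored (R : idomainType) : R -> Prop :=
| factored_unit u : u \is a GRing.unit -> factored u
| factored_prime p a : prime_elt p -> factored a -> factored (p * a).

Definition factorial_ring (R : idomainType) := forall a : R, a != 0 -> factored a.

Lemma factorial_field (F : fieldType) : factorial_ring F.
Proof. by move=> a a0; left; rewrite unitfE. Qed.

Section Factorial.
Variable R : idomainType.
Implicit Types (c : R) (p q : {poly R}).

Lemma factored_mul (S : idomainType) (a b : S) : factored a -> factored b -> factored (a * b).
Proof.
move=> fa fb; elim: fa => [u Uu|p c pp _ IH]; last by rewrite -mulrA; right.
elim: fb => [v Uv|p c pp _ IH]; first by left; rewrite unitrM Uu.
by rewrite mulrCA; right.
Qed.

Lemma dividesD (a b c : R) : divides a b -> divides a c -> divides a (b + c).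
Proof. by move=> [x ->] [y ->]; exists (x + y); rewrite mulrDr. Qed.

Lemma divides_polyCP c p :
  divides c%:P p <-> forall i, divides c p`_i.
Proof.
split=> [[q -> i]|]; first by exists q`_i; rewrite coefCM.
elim/poly_ind: p => [|p a IH] dv; first by exists 0; rewrite mulr0.
have [b] := dv 0%N; rewrite coefD coefMX coefC /= add0r => ->.
case: IH => [i|q ->].
  by have := dv i.+1; rewrite coefD coefMX coefC /= addr0.
by exists (q * 'X + b%:P); rewrite mulrDr mulrA polyCM.
Qed.

Lemma poly_decomp p :
  exists p1 a, p = p1 * 'X + a%:P /\ (p != 0 -> (size p1 < size p)%N).
Proof.
elim/poly_ind: p => [|p a _].
  by exists 0, 0; rewrite mul0r add0r eqxx.
exists p, a; split=> // p0.
rewrite size_MXaddC; case: ifP => [/andP[/eqP Dp /eqP Da]|_] //.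
by move: p0; rewrite Dp Da mul0r add0r eqxx.
Qed.

(* Compare lowest coefficients: if c divides that of p, strip it from p,
   otherwise strip the lowest coefficient of q. *)
Lemma prime_polyC c : prime_elt c -> prime_elt (c%:P : {poly R}).
Proof.
case=> c0 cU cP; split; first by rewrite polyC_eq0.
  by apply: contra cU; rewrite poly_unitE coefC eqxx => /andP[].
move=> p q; rewrite !divides_polyCP.
have [n] := ubnP (size p + size q); elim: n p q => // n IH p q.
have [->|p0] := eqVneq p 0; first by left=> i; exists 0; rewrite coef0 mulr0.
have [->|q0] := eqVneq q 0; first by right=> i; exists 0; rewrite coef0 mulr0.
have [p1 [a [Dp /(_ p0) lt_p]]] := poly_decomp p.
have [q1 [b [Dq /(_ q0) lt_q]]] := poly_decomp q.
rewrite ltnS => le_n dv.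
(* Dropping a lowest coefficient divisible by [c] alters the product, apart from a shift, only by
   multiples of [c]. *)
have strip r (t : {poly R}) s e :
    r * t = s -> (forall i, divides c s`_i) -> divides c e -> 
    forall r1, r = r1 * 'X + e%:P -> forall i, divides c (r1 * t)`_i.
  move=> Ds dvs [e1 De] r1 Dr i.
  have -> : (r1 * t)`_i = s`_i.+1 + c * (- (e1 * t`_i.+1)).
    rewrite -Ds Dr mulrDl coefD mulrAC coefMX /= coefCM De; ring.
  by apply: dividesD => //; exists (- (e1 * t`_i.+1)).
have join r e r1 : r = r1 * 'X + e%:P -> divides c e ->
    (forall i, divides c r1`_i) -> forall i, divides c r`_i.
  by move=> -> dve dv1 [|i]; rewrite coefD coefMX coefC /= ?add0r ?addr0.
have: divides c (a * b).
  by have := dv 0%N; rewrite Dp Dq coef0M !coefD !coefMX !coefC /= !add0r.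
case/cP=> [dva|dvb].
  have := strip p q _ a erefl dv dva _ Dp.
  case/IH => [|dv1|]; last by right.
    by apply: leq_trans le_n; rewrite ltn_add2r.
  by left; exact: (join _ _ _ Dp).
have := strip q p _ b (mulrC _ _) dv dvb _ Dq.
rewrite mulrC; case/IH => [|dv1|dv1]; last by right; exact: (join _ _ _ Dq).
  by apply: leq_trans le_n; rewrite ltn_add2l.
by left.
Qed.

Lemma polyZI c : c != 0 -> injective (fun p => c *: p).
Proof. by move=> c0 p q; rewrite -!mul_polyC => /mulfI; apply; rewrite polyC_eq0. Qed.

(** Gauss's lemma: by [prime_polyC] each prime factor of [c] divides [a] or [b] and is cancelled
    there. A factorization over the fraction field thus becomes, up to scalars, one over [R]. *)
Lemma gauss_split c p (a b : {poly R}) : factored c -> c *: p = a * b ->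
  exists al be a' b', [/\ a = al *: a', b = be *: b' & p = a' * b'].
Proof.
move=> fc; elim: fc a b => {c} [u Uu|c d cP _ IH] a b.
  move=> Dp; exists 1, u, a, (u^-1 *: b); split; rewrite ?scale1r //.
    by rewrite scalerA divrr ?scale1r.
  by rewrite -scalerAr -Dp scalerA mulVr ?scale1r.
rewrite -scalerA => Dp.
have [c0 _ _] := cP; have [_ _ /(_ a b)] := prime_polyC cP.
case; first by exists (d *: p); rewrite mul_polyC.
  case=> a1 Da; have: d *: p = a1 * b.
    by apply: (polyZI c0); rewrite Dp Da -mulrA mul_polyC.
  case/IH=> al [be [a' [b' [Da1 Db Dp']]]].
  exists (c * al), be, a', b'; split=> //.
  by rewrite Da Da1 mul_polyC scalerA.
case=> b1 Db; have: d *: p = a * b1.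
  by apply: (polyZI c0); rewrite Dp Db mulrCA mul_polyC.
case/IH=> al [be [a' [b' [Da Db1 Dp']]]].
exists al, (c * be), a', b'; split=> //.
by rewrite Db Db1 mul_polyC scalerA.
Qed.

Hypothesis facR : factorial_ring R.

Lemma prime_divides_or_unit c :
  c != 0 -> c \is a GRing.unit \/ exists2 p, prime_elt p & divides p c.
Proof.
by move=> /facR [u|p a pp _]; [left | right; exists p => //; exists a].
Qed.

(* Divisibility over the fraction field ([%|] on an integral domain is
   divisibility up to a nonzero scalar) by a primitive polynomial is
   divisibility. *)
Lemma dvdp_primitive (a p : {poly R}) : (1 < size a)%N ->
  (forall c, prime_elt c -> ~ divides c%:P a) -> a %| p -> divides a p.
Proof.
move=> sa prim /Pdiv.Idomain.dvdpP [[c q] /= c0 Dp].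
rewrite mulrC in Dp.
have [al [be [a' [b' [Da _ ->]]]]] := gauss_split (facR c0) Dp.
have al0 : al != 0 by apply: contraTneq sa => al0; rewrite Da al0 scale0r size_poly0.
case: (prime_divides_or_unit al0) => [Ual|[c1 c1P [d Dal]]].
  exists (al^-1 *: b').
  by rewrite Da -scalerAr -scalerAl scalerA mulVr ?scale1r.
exfalso; apply: (prim _ c1P); exists (d *: a').
by rewrite mul_polyC scalerA -Dal.
Qed.

(** By [gauss_split], [p] stays irreducible over the fraction field, where gcds make it prime;
    primitivity brings divisibility back to [R]. *)
Lemma irreducible_prime_poly p : (1 < size p)%N ->
  (forall c, prime_elt c -> ~ divides c%:P p) ->
  (forall a b : {poly R}, p = a * b -> (size a <= 1)%N \/ (size b <= 1)%N) ->
  prime_elt p.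
Proof.
move=> sp prim irr.
have p0 : p != 0 by rewrite -size_poly_gt0 ltnW.
split=> //; first by rewrite poly_unitE; case: eqP sp => // ->.
(* Over the fraction field, a nonconstant divisor of [p] is associated to [p]. *)
have irrp (q : {poly R}) : size q != 1 -> q %| p -> p %| q.
  move=> sq /Pdiv.Idomain.dvdpP [[c r] /= c0 Dp].
  have [al [be [a' [b' [Dr Dq Dp']]]]] := gauss_split (facR c0) Dp.
  have be0 : be != 0.
    apply/eqP => be0; move: Dp; rewrite Dq be0 scale0r mulr0 => Dp.
    by move/eqP: p0; apply; apply: (polyZI c0); rewrite /= Dp scaler0.
  rewrite Dq dvdpZr //.
  case: (irr _ _ Dp') => s1.
    have : size a' == 1%N.
      rewrite eqn_leq s1 size_poly_gt0; apply: contraTneq isT => a0.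
      by move: p0; rewrite Dp' a0 mul0r eqxx.
    case/size_poly1P => e e0 De.
    by rewrite Dp' De mul_polyC dvdpZl.
  have b'0 : b' != 0 by apply: contraNneq p0 => b0; rewrite Dp' b0 mulr0.
  case/negP: sq; rewrite Dq size_scale // eqn_leq s1 size_poly_gt0 //.
move=> a b [q Dab].
have dvab : p %| a * b by rewrite Dab dvdp_mulr.
case: (boolP (coprimep p a)) => [cop|].
  by right; apply: dvdp_primitive => //; rewrite -(Gauss_dvdpr _ cop).
rewrite coprimep_def => /irrp /(_ (dvdp_gcdl _ _)) dv.
by left; apply: dvdp_primitive => //; apply: dvdp_trans dv (dvdp_gcdr _ _).
Qed.

Lemma factored_polyC c : factored c -> factored (c%:P : {poly R}).
Proof.
elim=> [u Uu|d a dP _ IH].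
  have u0 : u != 0 by apply: contraTneq Uu => ->; rewrite unitr0.
  by left; rewrite poly_unitE size_polyC coefC eqxx u0 Uu.
by rewrite polyCM; right=> //; exact: prime_polyC.
Qed.

(* The invariant on [m] certifies that no prime factor of the leading
   coefficient processed so far divides [p]; once the leading coefficient is
   exhausted, [p] is primitive. *)
Lemma factored_primitive_part n (l : R) : factored l ->
  (forall q : {poly R}, (size q < n)%N -> q != 0 -> factored q) ->
  forall p m, (1 < size p <= n)%N -> lead_coef p = l * m ->
  (forall c, prime_elt c -> divides c m -> ~ divides c%:P p) -> factored p.
Proof.
move=> fl IHn; elim: fl => {l} [u Uu|l k lP _ IHl] p m /andP[s1 le_p] Dl inv.
  (* The leading coefficient is exhausted, so [p] is primitive: either it splits into factors of
     smaller degree or it is prime. *)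
  have [[a [b [Dp sa sb]]]|irr] :=
    classic (exists a b, [/\ p = a * b, (1 < size a)%N & (1 < size b)%N]).
    have a0 : a != 0 by rewrite -size_poly_gt0 ltnW.
    have b0 : b != 0 by rewrite -size_poly_gt0 ltnW.
    have Ds : size p = (size a + size b).-1 by rewrite Dp size_mul.
    rewrite Dp; apply: factored_mul; apply: IHn => //; apply: leq_trans le_p.
      by rewrite Ds -subn1 ltn_subRL addnC ltn_add2l.
    by rewrite Ds -subn1 ltn_subRL ltn_add2r.
  rewrite -[p]mulr1; right; last by left; rewrite unitr1.
  apply: irreducible_prime_poly => // [c cP dv|a b Dp].
    apply: (inv c cP) => //; case: dv => q Dq.
    exists (u^-1 * lead_coef q); rewrite mulrCA.
    have -> : c * lead_coef q = lead_coef p by rewrite Dq mul_polyC lead_coefZ.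
    by rewrite Dl mulrA mulVr // mul1r.
  case: (leqP (size a) 1) => sa; first by left.
  case: (leqP (size b) 1) => sb; first by right.
  by case: irr; exists a, b.
have [l0 _ _] := lP.
have [[q Dq]|ndv] := classic (divides l%:P p).
  rewrite mul_polyC in Dq.
  have sq : size q = size p by rewrite Dq size_scale.
  rewrite Dq -mul_polyC; right; first exact: prime_polyC.
  apply: (IHl _ m); rewrite ?sq ?s1 //.
    by move: Dl; rewrite Dq lead_coefZ -mulrA => /(mulfI l0).
  move=> c cP /(inv c cP) H [r Dr]; apply: H; exists (l *: r).
  by rewrite Dq Dr -scalerAr.
(* Now [l] joins the certified part [m]: a prime dividing [l] is associated to [l], hence does not
   divide [p]. *)
apply: (IHl _ (l * m)); rewrite ?s1 //; first by rewrite Dl mulrCA mulrA.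
move=> c cP [] // ; have [c0 cU cD] := cP.
move=> e De dv; have: divides c (l * m) by exists e.
case/cD => [[k' Dk]|/(inv c cP)//]; have [_ lU lD] := lP.
have: divides l (c * k') by rewrite -Dk; exists 1; rewrite mulr1.
case/lD => [[b Db]|[b Db]].
  by apply: ndv; case: dv => q ->; exists (b%:P * q); rewrite Db polyCM mulrA.
case/negP: cU; apply/unitrP; exists b; rewrite [b * c]mulrC.
suff -> : c * b = 1 by [].
by apply: (mulfI l0); rewrite mulr1 {2}Dk Db; ring.
Qed.

Lemma factorial_poly : factorial_ring {poly R}.
Proof.
move=> p; have [n] := ubnP (size p); elim: n p => // n IHn p.
rewrite ltnS => le_p p0; have [s1|s1] := leqP (size p) 1.
  rewrite [p]size1_polyC //; apply/factored_polyC/facR.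
  by apply: contraNneq p0 => c0; rewrite [p]size1_polyC // c0.
have fl : factored (lead_coef p) by apply: facR; rewrite lead_coef_eq0.
(* The certificate starts at m = 1, which no prime divides. *)
apply: (@factored_primitive_part n _ fl IHn p 1); rewrite ?mulr1 ?s1 //.
move=> c [_ cU _] [d Dd]; case/negP: cU; apply/unitrP.
by exists d; rewrite mulrC -Dd.
Qed.

End Factorial.

(** * Multivariate and iterated polynomials *)

Section PolynomialMaps.

Lemma poly_rmorph_ext (R S : nzRingType) (phi psi : {rmorphism {poly R} -> S}) :
  (forall c, phi c%:P = psi c%:P) -> phi 'X = psi 'X -> phi =1 psi.
Proof.
move=> eqC eqX; elim/poly_ind => [|p c IH]; first by rewrite !rmorph0.
by rewrite !rmorphD !rmorphM /= IH eqC eqX.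
Qed.

Lemma mpoly_rmorph_ext n (R : comNzRingType) (S : nzRingType)
    (phi psi : {rmorphism {mpoly R[n]} -> S}) :
  (forall c, phi c%:MP = psi c%:MP) -> (forall i, phi 'X_i = psi 'X_i) ->
  phi =1 psi.
Proof.
move=> eqC eqX p; rewrite [p]mpolyE !rmorph_sum /=; apply: eq_bigr => m _.
rewrite -mul_mpolyC !rmorphM /= eqC; congr (_ * _).
rewrite mpolyXE_id !rmorph_prod /=; apply: eq_bigr => i _.
by rewrite !rmorphXn /= eqX.
Qed.

Variable F : numClosedFieldType.

Definition duo (T : Type) (a b : T) : 'I_2 -> T :=
  fun i => if val i == 0%N then a else b.
Definition tri (T : Type) (a b c : T) : 'I_3 -> T :=
  fun i => if val i == 0%N then a else if val i == 1%N then b else c.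

(** Packaged as a ring morphism, so that two evaluations agree once they agree on the constants and
    on the variable. *)
Definition evalm (R S : comNzRingType) (phi : {rmorphism R -> S}) (a : S) :
    {rmorphism {poly R} -> S} :=
  horner_morph (fun x => mulrC a (phi x)).

Lemma evalmC (R S : comNzRingType) (phi : {rmorphism R -> S}) a c :
  evalm phi a c%:P = phi c.
Proof. exact: horner_morphC. Qed.
Lemma evalmX (R S : comNzRingType) (phi : {rmorphism R -> S}) a :
  evalm phi a 'X = a.
Proof. exact: horner_morphX. Qed.

(* The first coordinate becomes the outermost variable. *)
Definition poly2 : {rmorphism {mpoly F[2]} -> {poly {poly F}}} :=
  mmap (polyC \o polyC) (duo 'X 'X%:P).
Definition poly3 : {rmorphism {mpoly F[3]} -> {poly {poly {poly F}}}} :=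
  mmap (polyC \o (polyC \o polyC)) (tri 'X 'X%:P 'X%:P%:P).
Definition mpoly2 : {rmorphism {poly {poly F}} -> {mpoly F[2]}} :=
  evalm (evalm (@mpolyC 2 F) 'X_i2_1) 'X_ord0.
Definition mpoly3 : {rmorphism {poly {poly {poly F}}} -> {mpoly F[3]}} :=
  evalm (evalm (evalm (@mpolyC 3 F) 'X_i3_2) 'X_i3_1) 'X_ord0.
Definition eval2 (a b : F) : {rmorphism {poly {poly F}} -> F} :=
  evalm (evalm idfun b) a.
Definition eval3 (a b c : F) : {rmorphism {poly {poly {poly F}}} -> F} :=
  evalm (evalm (evalm idfun c) b) a.

Lemma I2P (P : 'I_2 -> Prop) : P ord0 -> P i2_1 -> forall i, P i.
Proof.
move=> P0 P1 [[|[|//]] lti]; first by rewrite (_ : Ordinal lti = ord0) //; apply: val_inj.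
by rewrite (_ : Ordinal lti = i2_1) //; apply: val_inj.
Qed.

Lemma I3P (P : 'I_3 -> Prop) : P ord0 -> P i3_1 -> P i3_2 -> forall i, P i.
Proof.
move=> P0 P1 P2 [[|[|[|//]]] lti].
- by rewrite (_ : Ordinal lti = ord0) //; apply: val_inj.
- by rewrite (_ : Ordinal lti = i3_1) //; apply: val_inj.
by rewrite (_ : Ordinal lti = i3_2) //; apply: val_inj.
Qed.

Lemma eval2_poly2 f a b : eval2 a b (poly2 f) = f.@[duo a b].
Proof.
apply: (mpoly_rmorph_ext (phi := eval2 a b \o poly2) (psi := meval (duo a b))).
  by move=> c /=; rewrite mevalC mmapC !evalmC.
by apply: I2P; rewrite /= mevalXU mmapX mmap1U /= ?evalmX ?evalmC ?evalmX.
Qed.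

Lemma eval3_poly3 f a b c : eval3 a b c (poly3 f) = f.@[tri a b c].
Proof.
apply: (mpoly_rmorph_ext (phi := eval3 a b c \o poly3) (psi := meval (tri a b c))).
  by move=> e /=; rewrite mevalC mmapC !evalmC.
by apply: I3P; rewrite /= mevalXU mmapX mmap1U /= ?evalmX ?evalmC ?evalmX ?evalmC ?evalmX.
Qed.

Lemma meval_mpoly2 p a b : (mpoly2 p).@[duo a b] = eval2 a b p.
Proof.
apply: (poly_rmorph_ext (phi := meval (duo a b) \o mpoly2) (psi := eval2 a b)).
  apply: (poly_rmorph_ext (phi := meval (duo a b) \o (mpoly2 \o polyC))
            (psi := eval2 a b \o polyC)) => [c|] /=.
    by rewrite !evalmC mevalC.
  by rewrite !(evalmC, evalmX) mevalXU.
by rewrite /= !evalmX mevalXU.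
Qed.

Lemma meval_mpoly3 p a b c : (mpoly3 p).@[tri a b c] = eval3 a b c p.
Proof.
pose v := tri a b c; pose P := @polyC {poly F}; pose Q := @polyC {poly {poly F}}.
apply: (poly_rmorph_ext (phi := meval v \o mpoly3) (psi := eval3 a b c)).
  apply: (poly_rmorph_ext (phi := meval v \o (mpoly3 \o Q)) (psi := eval3 a b c \o Q)) => [e|] /=.
    apply: (poly_rmorph_ext (phi := meval v \o (mpoly3 \o (Q \o P)))
              (psi := eval3 a b c \o (Q \o P))) => [k|] /=.
      by rewrite !evalmC mevalC.
    by rewrite !(evalmC, evalmX) mevalXU.
  by rewrite !(evalmC, evalmX) mevalXU.
by rewrite /= !evalmX mevalXU.
Qed.

Lemma poly2K : cancel poly2 mpoly2.
Proof.
apply: (mpoly_rmorph_ext (phi := mpoly2 \o poly2) (psi := idfun)).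
  by move=> c /=; rewrite mmapC !evalmC.
by apply: I2P; rewrite /= mmapX mmap1U /= ?evalmX ?evalmC ?evalmX.
Qed.

Lemma poly3K : cancel poly3 mpoly3.
Proof.
apply: (mpoly_rmorph_ext (phi := mpoly3 \o poly3) (psi := idfun)).
  by move=> c /=; rewrite mmapC !evalmC.
by apply: I3P; rewrite /= mmapX mmap1U /= ?evalmX ?evalmC ?evalmX ?evalmC ?evalmX.
Qed.

(** Among [size p] distinct integers one is not a root, as there are fewer roots than that. *)
Lemma poly_nonroot (R : idomainType) (p : {poly R}) :
  injective (fun n : nat => n%:R : R) -> p != 0 -> exists n, p.[n%:R] != 0.
Proof.
move=> inj p0; pose s := [seq (n%:R : R) | n <- iota 0 (size p)].
have us : uniq s by rewrite map_inj_uniq ?iota_uniq.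
case: (boolP (all (root p) s)) => [rs|/allPn[x /mapP[n _ ->] nr]]; last by exists n.
by have := max_poly_roots p0 rs us; rewrite size_map size_iota ltnn.
Qed.

Lemma natr_injF : injective (fun n : nat => n%:R : F).
Proof. by move=> m n /eqP; rewrite Num.Theory.eqr_nat => /eqP. Qed.

Lemma natr_inj_poly (R : nzRingType) : injective (fun n : nat => n%:R : R) ->
  injective (fun n : nat => n%:R : {poly R}).
Proof. by move=> inj m n; rewrite -!polyC_natr => /polyC_inj /inj. Qed.

Lemma eval2E a b p : eval2 a b p = p.[a%:P].[b].
Proof.
apply: (poly_rmorph_ext (phi := eval2 a b) (psi := horner_eval b \o horner_eval a%:P)).
  apply: (poly_rmorph_ext (phi := eval2 a b \o polyC)
            (psi := horner_eval b \o (horner_eval a%:P \o polyC))) => [c|] /=.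
    by rewrite !evalmC /= /horner_eval !hornerC.
  by rewrite evalmC evalmX /= /horner_eval hornerC hornerX.
by rewrite /= evalmX /horner_eval hornerX hornerC.
Qed.

Lemma eval3E a b c p : eval3 a b c p = eval2 b c p.[a%:P%:P].
Proof.
apply: (poly_rmorph_ext (phi := eval3 a b c) (psi := eval2 b c \o horner_eval a%:P%:P)).
  by move=> e; rewrite /= evalmC /horner_eval hornerC.
by rewrite /= evalmX /horner_eval hornerX !evalmC.
Qed.

(** The variables are specialized to integers one at a time, the outermost first. *)
Lemma eval2_nonzero (p : {poly {poly F}}) : p != 0 -> exists a b, eval2 a b p != 0.
Proof.
move=> p0; have [n pn] := poly_nonroot (natr_inj_poly natr_injF) p0.
have [m pm] := poly_nonroot natr_injF pn; exists n%:R, m%:R.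
by rewrite eval2E polyC_natr.
Qed.

Lemma eval3_nonzero (p : {poly {poly {poly F}}}) :
  p != 0 -> exists a b c, eval3 a b c p != 0.
Proof.
move=> p0; have [n pn] := poly_nonroot (natr_inj_poly (natr_inj_poly natr_injF)) p0.
have [b [c pbc]] := eval2_nonzero pn; exists n%:R, b, c.
by rewrite eval3E !polyC_natr.
Qed.

Lemma eval2_eq0 (p : {poly {poly F}}) : (forall a b, eval2 a b p = 0) -> p = 0.
Proof.
move=> p0; apply/eqP/negP => /negP /eval2_nonzero [a [b]].
by rewrite p0 eqxx.
Qed.

Lemma eval3_eq0 (p : {poly {poly {poly F}}}) :
  (forall a b c, eval3 a b c p = 0) -> p = 0.
Proof.
move=> p0; apply/eqP/negP => /negP /eval3_nonzero [a [b [c]]].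
by rewrite p0 eqxx.
Qed.

Lemma mpoly2_ext (p q : {mpoly F[2]}) :
  (forall a b, p.@[duo a b] = q.@[duo a b]) -> p = q.
Proof.
move=> eq_pq; apply: (can_inj poly2K); apply/eqP; rewrite -subr_eq0; apply/eqP.
by apply: eval2_eq0 => a b; rewrite rmorphB /= !eval2_poly2 eq_pq subrr.
Qed.

Lemma tri_eta T (v : 'I_3 -> T) : v =1 tri (v ord0) (v i3_1) (v i3_2).
Proof. exact: I3P. Qed.

End PolynomialMaps.
Arguments poly2 {F} : simpl never.
Arguments poly3 {F} : simpl never.
Arguments mpoly2 {F} : simpl never.
Arguments mpoly3 {F} : simpl never.

Lemma prod_I3 (R : comNzRingType) (G : 'I_3 -> R) :
  \prod_i G i = G ord0 * G i3_1 * G i3_2.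
Proof.
rewrite !big_ord_recl big_ord0 mulr1 mulrA.
by congr (_ * _ * _); congr G; apply: val_inj.
Qed.

Lemma sum_I3 (R : zmodType) (G : 'I_3 -> R) :
  \sum_i G i = G ord0 + G i3_1 + G i3_2.
Proof.
rewrite !big_ord_recl big_ord0 addr0 addrA.
by congr (_ + _ + _); congr G; apply: val_inj.
Qed.

Lemma sum_I2 (R : zmodType) (G : 'I_2 -> R) :
  \sum_i G i = G ord0 + G i2_1.
Proof.
rewrite !big_ord_recl big_ord0 addr0.
by congr (_ + _); congr G; apply: val_inj.
Qed.

Section CoefPoly3.
Variable F : numClosedFieldType.

Lemma poly3_monomial c (m : 'X_{1..3}) :
  @poly3 F (c *: 'X_[m]) =
  ((c%:P * 'X^(m i3_2))%:P * 'X^(m i3_1))%:P * 'X^(m ord0).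
Proof.
rewrite -mul_mpolyC rmorphM /= mmapC mmapX /mmap1 prod_I3 /=.
rewrite /tri /= !polyCM !polyC_exp.
by rewrite -!mulrA; congr (_ * _); rewrite mulrC -mulrA; exact: mulrCA.
Qed.

Lemma coef_poly3 (g : {mpoly F[3]}) (m : 'X_{1..3}) :
  (poly3 g)`_(m ord0)`_(m i3_1)`_(m i3_2) = g@_m.
Proof.
rewrite [in RHS](mpolyE g) [g in LHS]mpolyE (rmorph_sum (@poly3 F)).
rewrite !coef_sum [RHS]raddf_sum.  apply: eq_bigr => k _.
rewrite poly3_monomial [RHS]mcoeffZ mcoeffX.
rewrite coefCM coefXn mulr_natr !coefMn.
rewrite coefCM coefXn mulr_natr !coefMn coefCM coefXn.
rewrite [RHS]mulr_natr mulr_natr -!mulrnA; congr (_ *+ _).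
have [->|nkm] := eqVneq k m; first by rewrite !eqxx.
case: eqP => //= e2; case: eqP => //= e1; case: eqP => //= e0.
by case/eqP: nkm; apply/mnmP; apply: I3P.
Qed.

(** Identifies the degree in x1 of the statement with the degree of the iterated polynomial in its
    outermost variable. *)
Lemma size_poly3 (g : {mpoly F[3]}) :
  g != 0 -> size (poly3 g) = (\max_(m <- msupp g) m ord0).+1.
Proof.
move=> g0; apply/eqP; rewrite eqn_leq; apply/andP; split.
  apply/leq_sizeP => j le_j.
  rewrite [g]mpolyE (rmorph_sum (@poly3 F)) coef_sum big_seq big1 // => m gm.
  rewrite poly3_monomial coefCM coefXn.
  case: eqP le_j => [->|_]; last by rewrite mulr0.
  have le_m : (m ord0 <= \max_(m <- msupp g) m ord0)%N.
    by rewrite (big_rem m gm) leq_maxl.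
  by rewrite ltnNge le_m.
have [m gm ->] : exists2 m, m \in msupp g & \max_(m <- msupp g) m ord0 = m ord0.
  have : msupp g != [::] by rewrite msupp_eq0.
  elim: (msupp g) => // m [|m' s] IH _.
    by exists m; rewrite ?inE // big_cons big_nil maxn0.
  have [//|m1 m1s Dm1] := IH; rewrite big_cons Dm1.
  case: (leqP (m ord0) (m1 ord0)) => _.
    by exists m1; rewrite // inE m1s orbT.
  by exists m; rewrite ?inE ?eqxx.
rewrite ltnNge; apply/negP => /leq_sizeP /(_ _ (leqnn _)) c0.
move: gm; rewrite mcoeff_msupp -coef_poly3 c0 !coef0 eqxx //.
Qed.
End CoefPoly3.

(** * Plane curves *)

Section Curves.
Variable F : numClosedFieldType.

Lemma mpoly_ring_ind n (K : {mpoly F[n]} -> Prop) :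
  (forall c, K c%:MP) -> (forall i, K 'X_i) ->
  (forall p q, K p -> K q -> K (p + q)) ->
  (forall p q, K p -> K q -> K (p * q)) -> forall p, K p.
Proof.
move=> KC KX KD KM p; rewrite [p]mpolyE.
apply: (big_ind K) => [||m _]; [by rewrite -mpolyC0 | exact: KD |].
rewrite -mul_mpolyC; apply: (KM) => //; rewrite mpolyXE_id.
apply: (big_ind K) => [||i _]; [by rewrite -mpolyC1 | exact: KM |].
by elim: (m i) => [|k IH]; rewrite ?expr0 -?mpolyC1 // exprS; apply: KM.
Qed.

(** Restriction of a polynomial to the parametrized arc [P]; derivatives along arcs are then
    derivatives of univariate polynomials. *)
Definition along n (P : 'I_n -> {poly F}) : {rmorphism {mpoly F[n]} -> {poly F}} :=
  mmap polyC P.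

Arguments along : simpl never.

Lemma alongC n (P : 'I_n -> {poly F}) c : along P c%:MP = c%:P.
Proof. exact: mmapC. Qed.

Lemma alongX n (P : 'I_n -> {poly F}) i : along P 'X_i = P i.
Proof. by rewrite /along /= mmapX mmap1U. Qed.

Lemma alongE n P (h : {mpoly F[n]}) a : (along P h).[a] = h.@[fun i => (P i).[a]].
Proof.
apply: (mpoly_rmorph_ext (phi := horner_eval a \o along P)) => [c|i] /=.
  by rewrite mevalC ?alongC /horner_eval hornerC.
by rewrite mevalXU ?alongX.
Qed.

(** Chain rule, checked on constants and variables and carried through sums and products. *)
Lemma deriv_along n P (h : {mpoly F[n]}) :
  (along P h)^`() = \sum_i along P h^`M(i) * (P i)^`().
Proof.
elim/mpoly_ring_ind: h => [c|i|p q IHp IHq|p q IHp IHq].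
- rewrite alongC derivC big1 // => i _.
  by rewrite mderivC rmorph0 mul0r.
- rewrite alongX (bigD1 i) //= big1 ?addr0 => [|j ji].
    rewrite mderivX mnmE eqxx scale1r (_ : (U_(i) - U_(i) = 0)%MM).
      by rewrite mpolyX0 rmorph1 mul1r.
    by apply/mnmP => k; rewrite mnmBE subnn mnmE.
  by rewrite mderivX mnmE eq_sym (negPf ji) scale0r rmorph0 mul0r.
- rewrite rmorphD derivD IHp IHq -big_split /=; apply: eq_bigr => i _.
  by rewrite -mulrDl mderivD rmorphD.
rewrite rmorphM derivM IHp IHq mulr_suml mulr_sumr -big_split.
apply: eq_bigr => i _; rewrite mderivM rmorphD !rmorphM /=.
by rewrite mulrDl mulrAC !mulrA.
Qed.

Lemma horner_deriv_along n P (h : {mpoly F[n]}) a :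
  ((along P h)^`()).[a] =
  \sum_i (h^`M(i)).@[fun j => (P j).[a]] * ((P i)^`()).[a].
Proof.
rewrite deriv_along horner_sum; apply: eq_bigr => i _.
by rewrite hornerM alongE.
Qed.

(** Even and odd parts in d, both written in d^2: the squared distance is polynomial along a normal
    line, whereas d involves a square root of the squared gradient norm. *)
Lemma even_odd_split (g : {mpoly F[3]}) : exists E O : {mpoly F[3]},
  forall a b d, g.@[tri a b d] = E.@[tri a b (d ^+ 2)] + d * O.@[tri a b (d ^+ 2)].
Proof.
elim/mpoly_ring_ind: g => [c||p q|p q].
- exists c%:MP, 0 => a b d; rewrite meval0 !mevalC; ring.
- apply: I3P; [exists 'X_ord0, 0 | exists 'X_i3_1, 0 | exists 0, 1] => a b d.
  + by rewrite !mevalXU meval0 mulr0 addr0.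
  + by rewrite !mevalXU meval0 mulr0 addr0.
  by rewrite !mevalXU meval0 meval1 mulr1 add0r.
- move=> [E1 [O1 H1]] [E2 [O2 H2]]; exists (E1 + E2), (O1 + O2) => a b d.
  by rewrite !mevalD H1 H2; ring.
move=> [E1 [O1 H1]] [E2 [O2 H2]].
(* The product of the two odd parts carries d^2, which is the third variable. *)
exists (E1 * E2 + 'X_i3_2 * O1 * O2), (E1 * O2 + O1 * E2) => a b d.
by rewrite !(mevalD, mevalM) H1 H2 mevalXU /tri /=; ring.
Qed.

(** The constant [r] plays the role of a resultant: at parameters where it does not vanish, [p] and
    [q] have no common root. *)
Lemma bezout_scalar (R : idomainType) (p q : {poly R}) : coprimep p q ->
  exists U V r, r != 0 /\ U * p + V * q = r%:P.
Proof.
case/Pdiv.Idomain.Bezout_coprimepP => [[U V]] /= /eqpP [[c1 c2] /= /andP[c10 c20] D].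
exists (c1 *: U), (c1 *: V), c2; split=> //.
by rewrite -!scalerAl -scalerDr D alg_polyC.
Qed.

Definition irreducible_mpoly n (h : {mpoly F[n]}) :=
  (forall c, h <> c%:MP) /\
  forall a b, h = a * b -> (exists c, a = c%:MP) \/ (exists c, b = c%:MP).

Lemma mpoly2_const p c : @mpoly2 F p = c%:MP -> p = c%:P%:P.
Proof.
move=> Dp; apply/eqP; rewrite -subr_eq0; apply/eqP/eval2_eq0 => a b.
by rewrite rmorphB /= -meval_mpoly2 Dp mevalC !evalmC subrr.
Qed.

Lemma mpoly3_const p c : @mpoly3 F p = c%:MP -> p = c%:P%:P%:P.
Proof.
move=> Dp; apply/eqP; rewrite -subr_eq0; apply/eqP/eval3_eq0 => a b d.
by rewrite rmorphB /= -meval_mpoly3 Dp mevalC !evalmC subrr.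
Qed.

Variable f : {mpoly F[2]}.
Hypothesis irr_f : irreducible_mpoly f.
Hypothesis deg_f : (1 < size (poly2 f))%N.

Let irr_poly2 p q : poly2 f = p * q -> 
  (exists2 c, p = c%:P%:P & c != 0) \/ (exists2 c, q = c%:P%:P & c != 0).
Proof.
move=> Df; have f0 : poly2 f != 0 by rewrite -size_poly_gt0 ltnW.
have [_ /(_ (mpoly2 p) (mpoly2 q))] := irr_f.
rewrite -rmorphM -Df poly2K => /(_ erefl) [] [c /mpoly2_const Dc];
  [left|right]; exists c => //; apply: contraNneq f0 => c0;
  by rewrite Df Dc c0 !polyC0 ?mul0r ?mulr0.
Qed.

(** A nonconstant divisor in y2 alone would leave a constant cofactor, against the positive degree
    of [f] in y1. *)
Lemma primitive_poly2 c : prime_elt c -> ~ divides c%:P (poly2 f).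
Proof.
move=> [c0 cU _] [q Df]; case: (irr_poly2 Df) => [[e /polyC_inj De e0]|[e De e0]].
  by case/negP: cU; rewrite De poly_unitE size_polyC coefC eqxx e0 unitfE e0.
by move: deg_f; rewrite Df De -polyCM size_polyC; case: eqP.
Qed.

(** By Gauss's lemma a common factor over the field of fractions in y2 descends to a factor of [f],
    so it is [f] up to a scalar; [f] being primitive, it then divides [a]. *)
Lemma irreducible_coprime a : ~ (exists q, a = f * q) ->
  coprimep (poly2 f) (poly2 a).
Proof.
move=> ndv; rewrite coprimep_def; apply/negPn/negP => sd.
set d := gcdp _ _ in sd.
have f0 : poly2 f != 0 by rewrite -size_poly_gt0 ltnW.
have facF : factorial_ring {poly F} by apply/factorial_poly/factorial_field.
have d0 : d != 0 by rewrite gcdp_eq0 (negPf f0).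
have [c [q [c0 Df]]] : exists c q, c != 0 /\ c *: poly2 f = q * d.
  have /Pdiv.Idomain.dvdpP [[c q] c0 Df] : d %| poly2 f by apply: dvdp_gcdl.
  by exists c, q.
have [al [be [q' [d' [Dq Dd Df']]]]] := gauss_split (facF _ c0) Df.
have be0 : be != 0 by apply: contraNneq d0 => be0; rewrite Dd be0 scale0r.
case: (irr_poly2 Df') => [[e De e0]|[e De e0]]; last first.
  by case/negP: sd; rewrite Dd size_scale // De size_polyC polyC_eq0 e0.
have dvf : poly2 f %| poly2 a.
  apply: dvdp_trans (dvdp_gcdr (poly2 f) _); rewrite -/d Dd Df' De mul_polyC.
  by rewrite dvdpZr // dvdpZl ?polyC_eq0.
have [q1 Da] := dvdp_primitive facF deg_f primitive_poly2 dvf.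
by case: ndv; exists (mpoly2 q1); rewrite -[a]poly2K Da rmorphM /= poly2K.
Qed.

(** The Bezout identity eliminates y1; the finitely many roots of [r] bound the heights of the
    common zeros. *)
Lemma common_zeros_finite a : ~ (exists q, a = f * q) ->
  exists2 r : {poly F}, r != 0 &
    forall y1 y2, f.@[duo y1 y2] = 0 -> a.@[duo y1 y2] = 0 -> r.[y2] = 0.
Proof.
case/irreducible_coprime/bezout_scalar => [U [V [r [r0 D]]]]; exists r => // y1 y2 f0 a0.
have := congr1 (eval2 y1 y2) D.
by rewrite rmorphD !rmorphM /= !eval2_poly2 f0 a0 !mulr0 addr0 eval2E !hornerC.
Qed.

(** At a height y2 avoiding the roots of [r] and of the leading coefficient, [f] is still
    nonconstant in y1 and has a root. *)
Lemma curve_point (r : {poly F}) : r != 0 ->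
  exists y1 y2, f.@[duo y1 y2] = 0 /\ r.[y2] != 0.
Proof.
move=> r0; have l0 : lead_coef (poly2 f) != 0.
  by rewrite lead_coef_eq0 -size_poly_gt0 ltnW.
have [n] := poly_nonroot (@natr_injF F) (mulf_neq0 r0 l0).
rewrite hornerM mulf_eq0 negb_or; set b := n%:R => /andP[rb lb].
pose pb := map_poly (evalm idfun b) (poly2 f).
have eb : evalm idfun b (lead_coef (poly2 f)) != 0.
  by rewrite /= /horner_morph map_poly_id.
have /closed_rootP [a /rootP pa] : size pb != 1%N.
  by rewrite size_map_poly_id0 // neq_ltn deg_f orbT.
by exists a, b; rewrite -eval2_poly2.
Qed.

(** Stands in for the Nullstellensatz: if [f] divided neither [h] nor [a], some point of the curve
    would avoid the zeros of both. *)
Lemma vanishing_divisible h a : ~ (exists q, h = f * q) ->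
  (forall y1 y2, f.@[duo y1 y2] = 0 -> h.@[duo y1 y2] != 0 -> a.@[duo y1 y2] = 0) ->
  exists q, a = f * q.
Proof.
move=> ndh vana; have [//|nda] := classic (exists q, a = f * q).
have [r r0 rP] := common_zeros_finite ndh; have [s s0 sP] := common_zeros_finite nda.
have [y1 [y2 [fy]]] := curve_point (mulf_neq0 r0 s0).
rewrite hornerM mulf_eq0 negb_or => /andP[/eqP ry /eqP sy].
case: sy; apply: (sP y1) => //; apply: vana => //.
by apply/eqP => hy; apply: ry; apply: (rP y1).
Qed.

End Curves.

(** * The normal vector of an offset pair *)

Section Tangency.
Variables (F : numClosedFieldType) (f : {mpoly F[2]}).

Definition norm_gradient : {mpoly F[2]} := f^`M(ord0) ^+ 2 + f^`M(i2_1) ^+ 2.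

(** The equations of the incidence variety with u eliminated, u being the inverse of the squared
    gradient norm. *)
Record offset_pair (y1 y2 x1 x2 d : F) : Prop := OffsetPair {
  on_curve : f.@[duo y1 y2] = 0;
  non_isotropic : norm_gradient.@[duo y1 y2] != 0;
  on_normal : f^`M(i2_1).@[duo y1 y2] * (x1 - y1) =
              f^`M(ord0).@[duo y1 y2] * (x2 - y2);
  at_distance : (x1 - y1) ^+ 2 + (x2 - y2) ^+ 2 = d ^+ 2 }.

Lemma poly_eq0_punctured (p : {poly F}) : (forall x, x != 0 -> p.[x] = 0) -> p = 0.
Proof.
move=> p0; apply/eqP/negP => /negP pn0.
have [n] := poly_nonroot (@natr_injF F) (mulf_neq0 pn0 (negbT (polyX_eq0 F))).
rewrite hornerM hornerX mulf_eq0 negb_or => /andP[pn n0].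
by rewrite p0 ?eqxx in pn.
Qed.

Lemma poly_eq_ext (p q : {poly F}) : (forall x, p.[x] = q.[x]) -> p = q.
Proof.
move=> pq; apply/eqP; rewrite -subr_eq0; apply/eqP/poly_eq0_punctured => x _.
by rewrite hornerD hornerN pq subrr.
Qed.

Definition subst3 (Q : 'I_3 -> {mpoly F[2]}) : {rmorphism {mpoly F[3]} -> {mpoly F[2]}} :=
  mmap (@mpolyC 2 F) Q.
Arguments subst3 : simpl never.

Lemma subst3C Q c : subst3 Q c%:MP = c%:MP.
Proof. exact: mmapC. Qed.

Lemma subst3X Q i : subst3 Q 'X_i = Q i.
Proof. by rewrite /subst3 /= mmapX mmap1U. Qed.

Lemma meval_subst3 Q v E : (subst3 Q E).@[v] = E.@[fun i => (Q i).@[v]].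
Proof.
apply: (mpoly_rmorph_ext (phi := meval v \o subst3 Q)) => [c|i] /=.
  by rewrite subst3C !mevalC.
by rewrite subst3X mevalXU.
Qed.

Lemma along_subst3 Q P E : along P (subst3 Q E) = along (fun i => along P (Q i)) E.
Proof.
apply: (mpoly_rmorph_ext (phi := along P \o subst3 Q)
          (psi := along (fun i => along P (Q i)))) => [c|i] /=.
  by rewrite subst3C !alongC.
by rewrite subst3X alongX.
Qed.

Hypothesis irr_f : irreducible_mpoly f.
Hypothesis deg_f : (1 < size (poly2 f))%N.
Hypothesis ndh : ~ exists q, norm_gradient = f * q.

Section AtPoint.
Variables y1 y2 f1 f2 h : F.
Hypothesis fy : f.@[duo y1 y2] = 0.
Hypothesis f1E : f^`M(ord0).@[duo y1 y2] = f1.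
Hypothesis f2E : f^`M(i2_1).@[duo y1 y2] = f2.
Hypothesis normE : norm_gradient.@[duo y1 y2] = h.
Hypothesis hy : h != 0.

Let hE : h = f1 ^+ 2 + f2 ^+ 2.
Proof. by rewrite -normE /norm_gradient mevalD !expr2 !mevalM f1E f2E. Qed.

(* In terms of the squared distance, the points (y + l grad f, l^2 |grad f|^2)
   are polynomial in y for fixed l, so that the vanishing of E at them is
   divisibility of a polynomial by f. *)
Section SquaredDistance.
Variable E : {mpoly F[3]}.
Hypothesis vanE : forall y1 y2 l, f.@[duo y1 y2] = 0 ->
  norm_gradient.@[duo y1 y2] != 0 -> l != 0 ->
  E.@[tri (y1 + l * f^`M(ord0).@[duo y1 y2]) (y2 + l * f^`M(i2_1).@[duo y1 y2])
          (l ^+ 2 * norm_gradient.@[duo y1 y2])] = 0.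

Local Notation z l := (tri (y1 + l * f1) (y2 + l * f2) (l ^+ 2 * h)).
Local Notation e i l := (E^`M(i).@[z l]).

Let P := tri (y1%:P + f1 *: 'X) (y2%:P + f2 *: 'X) (h *: 'X^2).

Let Pz x : (fun i => (P i).[x]) =1 z x.
Proof.
by apply: I3P; rewrite /P /tri /= ?(hornerD, hornerC, hornerZ, hornerX, hornerXn) mulrC.
Qed.

Let dP0 l : ((P ord0)^`()).[l] = f1.
Proof. by rewrite /P /tri /= derivD derivC derivZ derivX add0r hornerZ hornerC mulr1. Qed.
Let dP1 l : ((P i3_1)^`()).[l] = f2.
Proof. by rewrite /P /tri /= derivD derivC derivZ derivX add0r hornerZ hornerC mulr1. Qed.
Let dP2 l : ((P i3_2)^`()).[l] = h * (l *+ 2).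
Proof. by rewrite /P /tri /= derivZ derivXn hornerZ hornerMn hornerXn. Qed.

(** [E] vanishes along the normal line at y for all nonzero parameters, hence identically; this is
    its derivative in the parameter. *)
Lemma radial_derivative l : e ord0 l * f1 + e i3_1 l * f2 + 2 * l * h * e i3_2 l = 0.
Proof.
have P0 : along P E = 0.
  apply: poly_eq0_punctured => x x0; rewrite alongE (meval_eq _ (Pz x)).
  by rewrite -f1E -f2E -normE; apply: vanE; rewrite ?normE.
have := horner_deriv_along P E l.
rewrite P0 deriv0 horner0 sum_I3 !(meval_eq _ (Pz l)) dP0 dP1 dP2.
by move=> D; rewrite -[RHS]/(0 : F) [RHS]D; ring.
Qed.

(** [T1] and [T2] are the derivatives of f1 and f2 in the tangent direction (-f2, f1). *)
Let T1 := f^`M(ord0)^`M(ord0).@[duo y1 y2] * - f2 + f^`M(ord0)^`M(i2_1).@[duo y1 y2] * f1.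
Let T2 := f^`M(i2_1)^`M(ord0).@[duo y1 y2] * - f2 + f^`M(i2_1)^`M(i2_1).@[duo y1 y2] * f1.

(** Here l is fixed and y moves along the curve; [Q] is the map sending y to the point at parameter
    l on its normal. *)
Lemma tangential_derivative l : l != 0 ->
  e ord0 l * (l * T1 - f2) + e i3_1 l * (l * T2 + f1) +
  e i3_2 l * (l ^+ 2 * (2 * f1 * T1 + 2 * f2 * T2)) = 0.
Proof.
move=> l0.
pose Q := tri ('X_ord0 + l%:MP * f^`M(ord0)) ('X_i2_1 + l%:MP * f^`M(i2_1))
              ((l ^+ 2)%:MP * norm_gradient).
have Qz v : (fun i => (Q i).@[v]) =1
    tri (v ord0 + l * f^`M(ord0).@[v]) (v i2_1 + l * f^`M(i2_1).@[v])
        (l ^+ 2 * norm_gradient.@[v]).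
  apply: I3P; rewrite /Q /tri /=; last by rewrite mevalM mevalC.
    by rewrite mevalD mevalM mevalC mevalXU.
  by rewrite mevalD mevalM mevalC mevalXU.
have [q Dq] : exists q, subst3 Q E = f * q.
  apply: (vanishing_divisible irr_f deg_f ndh) => a b fab hab.
  by rewrite meval_subst3 (meval_eq _ (Qz _)); apply: vanE.
(* The tangent line replaces the curve: for a multiple of [f], first order contact at y is
   enough. *)
pose Y := duo (y1%:P - f2 *: 'X) (y2%:P + f1 *: 'X).
have Y0 : (fun i => (Y i).[0]) =1 duo y1 y2.
  by apply: I2P; rewrite /Y /duo /= ?hornerD ?hornerN hornerC hornerZ hornerX mulr0 ?subr0 ?addr0.
have dY0 : ((Y ord0)^`()).[0] = - f2.
  by rewrite /Y /duo /= derivB derivC derivZ derivX sub0r hornerN hornerZ hornerC mulr1.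
have dY1 : ((Y i2_1)^`()).[0] = f1.
  by rewrite /Y /duo /= derivD derivC derivZ derivX add0r hornerZ hornerC mulr1.
have dP (a : {mpoly F[2]}) : ((along Y a)^`()).[0] =
    a^`M(ord0).@[duo y1 y2] * - f2 + a^`M(i2_1).@[duo y1 y2] * f1.
  by rewrite horner_deriv_along sum_I2 !(meval_eq _ Y0) dY0 dY1.
(* Both [f] and its tangential derivative vanish at y, so the product rule leaves nothing. *)
have D0 : ((along Y (subst3 Q E))^`()).[0] = 0.
  rewrite Dq (rmorphM (along Y)) derivM hornerD !hornerM dP !alongE !(meval_eq _ Y0) fy.
  by rewrite f1E f2E; ring.
move: D0; rewrite along_subst3 horner_deriv_along.
have YQz : (fun j => (along Y (Q j)).[0]) =1 z l.
  by move=> j; rewrite alongE (meval_eq _ Y0) [LHS]Qz f1E f2E normE.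
rewrite sum_I3 !(meval_eq _ YQz) !dP.
have dX i j : ('X_i : {mpoly F[2]})^`M(j).@[duo y1 y2] = (i == j)%:R.
  rewrite mderivX mnmE; case: eqP => [->|_]; last by rewrite scale0r meval0.
  rewrite scale1r (_ : (U_(j) - U_(j) = 0)%MM) ?mpolyX0 ?meval1 //.
  by apply/mnmP => k; rewrite mnmBE subnn mnmE.
have dlin i c (a : {mpoly F[2]}) j : ('X_i + c%:MP * a)^`M(j).@[duo y1 y2] =
    (i == j)%:R + c * a^`M(j).@[duo y1 y2].
  by rewrite mderivD mderiv_mulC mevalD mevalM mevalC dX.
have dnorm j : norm_gradient^`M(j).@[duo y1 y2] =
    2 * f1 * f^`M(ord0)^`M(j).@[duo y1 y2] + 2 * f2 * f^`M(i2_1)^`M(j).@[duo y1 y2].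
  by rewrite /norm_gradient mderivD !expr2 !mderivM !mevalD !mevalM f1E f2E; ring.
rewrite [Q ord0]/(_ + _) [Q i3_1]/(_ + _) [Q i3_2]/(_ * _).
rewrite !dlin !mderiv_mulC !mevalM !mevalC !dnorm /=.
by move=> D; rewrite -[RHS]D /T1 /T2; ring.
Qed.

(** Eliminating the third partial derivative leaves the claim multiplied by h + kappa l, where
    [kappa] is the curvature up to normalization. This factor vanishes only at the centre of
    curvature; as a polynomial in l it is nonzero because h is, so it cancels for every l. *)
Lemma tangential_vanishing l : l != 0 -> - f2 * e ord0 l + f1 * e i3_1 l = 0.
Proof.
move=> l0; pose kappa := f1 * T2 - f2 * T1.
pose p := - f2 *: along P E^`M(ord0) + f1 *: along P E^`M(i3_1).
have pE x : p.[x] = - f2 * e ord0 x + f1 * e i3_1 x.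
  by rewrite /p hornerD !hornerZ !alongE !(meval_eq _ (Pz x)).
suff p0 : p = 0 by rewrite -pE p0 horner0.
have : (h%:P + kappa *: 'X) * p = 0.
  apply: poly_eq0_punctured => x x0.
  rewrite hornerM hornerD hornerC hornerZ hornerX pE.
  (* h Dt - x (f1 T1 + f2 T2) Dr = (h + kappa x) (t . grad E) *)
  have Dr := radial_derivative x; have Dt := tangential_derivative x0.
  rewrite -[RHS](mulr0 h) -[in RHS]Dt -[LHS]subr0.
  rewrite -{1}(mulr0 (- (x * (f1 * T1 + f2 * T2)))) -[in X in _ - X]Dr /kappa hE; ring.
move/eqP; rewrite mulf_eq0 => /orP[/eqP q0|/eqP //].
have := congr1 (horner^~ 0) q0.
by rewrite hornerD hornerC hornerZ hornerX mulr0 addr0 horner0 => /eqP; rewrite (negPf hy).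
Qed.

End SquaredDistance.
End AtPoint.
End Tangency.

(** * From squared distance to signed distance *)

Section NormalVector.
Variables (F : numClosedFieldType) (f : {mpoly F[2]}).
Hypothesis irr_f : irreducible_mpoly f.
Hypothesis deg_f : (1 < size (poly2 f))%N.
Hypothesis ndh : ~ exists q, norm_gradient f = f * q.

(** In directions other than d the factor d is constant, so the splitting can be differentiated on a
    line in direction [i]. *)
Lemma even_odd_split_deriv (g E O : {mpoly F[3]}) :
  (forall a b d, g.@[tri a b d] = E.@[tri a b (d ^+ 2)] + d * O.@[tri a b (d ^+ 2)]) ->
  forall i, i != i3_2 -> forall a b d,
  g^`M(i).@[tri a b d] =
  E^`M(i).@[tri a b (d ^+ 2)] + d * O^`M(i).@[tri a b (d ^+ 2)].
Proof.
move=> split i i2 a b d.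
pose X j : {poly F} := (i == j)%:R *: 'X.
pose P c := tri (a%:P + X ord0) (b%:P + X i3_1) c%:P.
have Px c x : (fun j => (P c j).[x]) =1
    tri (a + (i == ord0)%:R * x) (b + (i == i3_1)%:R * x) c.
  by apply: I3P; rewrite /P /tri /= ?hornerD hornerC // hornerZ hornerX.
have P0 c : (fun j => (P c j).[0]) =1 tri a b c.
  by move=> j; rewrite Px !mulr0 !addr0.
have dP c j : ((P c j)^`()).[0] = (i == j)%:R.
  by move: j; apply: I3P; rewrite /P /tri /= ?derivD derivC ?add0r ?derivZ ?derivX
    ?hornerZ hornerC ?mulr1 // (negPf i2).
have D (q : {mpoly F[3]}) c : ((along (P c) q)^`()).[0] = q^`M(i).@[tri a b c].
  rewrite horner_deriv_along (bigD1 i) //= dP eqxx mulr1 (meval_eq _ (P0 c)) big1 ?addr0 //.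
  by move=> j ji; rewrite dP eq_sym (negPf ji) mulr0.
rewrite -!D.
have -> : along (P d) g = along (P (d ^+ 2)) E + d *: along (P (d ^+ 2)) O.
  apply: poly_eq_ext => x.
  by rewrite hornerD hornerZ !alongE !(meval_eq _ (Px _ x)) split.
by rewrite derivD derivZ hornerD hornerZ.
Qed.

Lemma offset_pair_param y1 y2 l delta :
  f.@[duo y1 y2] = 0 -> (norm_gradient f).@[duo y1 y2] != 0 ->
  delta ^+ 2 = (norm_gradient f).@[duo y1 y2] ->
  offset_pair f y1 y2 (y1 + l * f^`M(ord0).@[duo y1 y2])
    (y2 + l * f^`M(i2_1).@[duo y1 y2]) (l * delta).
Proof.
move=> fy hy dE; split=> //; first by ring.
by rewrite exprMn dE /norm_gradient mevalD !expr2 !mevalM; ring.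
Qed.

Variable g : {mpoly F[3]}.
Hypothesis van_g : forall y1 y2 x1 x2 d,
  d != 0 -> offset_pair f y1 y2 x1 x2 d -> g.@[tri x1 x2 d] = 0.

(** Both square roots of the squared gradient norm give offset pairs over the same x, at opposite
    distances; adding and subtracting the two values of [g] isolates [E] and [O]. *)
Lemma van_even_odd E O :
  (forall a b d, g.@[tri a b d] = E.@[tri a b (d ^+ 2)] + d * O.@[tri a b (d ^+ 2)]) ->
  forall y1 y2 l, f.@[duo y1 y2] = 0 ->
  (norm_gradient f).@[duo y1 y2] != 0 -> l != 0 ->
  let z := tri (y1 + l * f^`M(ord0).@[duo y1 y2]) (y2 + l * f^`M(i2_1).@[duo y1 y2])
          (l ^+ 2 * (norm_gradient f).@[duo y1 y2]) in E.@[z] = 0 /\ O.@[z] = 0.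
Proof.
move=> split y1 y2 l fy hy l0 z.
have [s s2] : exists s : F, s ^+ 2 = (norm_gradient f).@[duo y1 y2] :=
  ex_intro _ _ (Num.Theory.sqrtCK _).
have s0 : s != 0 by apply: contraNneq hy => s0; rewrite -s2 s0 expr0n.
have ms2 : (- s) ^+ 2 = (norm_gradient f).@[duo y1 y2] by rewrite sqrrN.
have ls0 : l * s != 0 by rewrite mulf_neq0.
have nls0 : l * - s != 0 by rewrite mulrN oppr_eq0.
have Dp := van_g ls0 (offset_pair_param l fy hy s2).
have Dm := van_g nls0 (offset_pair_param l fy hy ms2).
move: Dp Dm; rewrite !split !exprMn s2 ms2 -/z => Dp Dm.
have two0 : (2 : F) != 0 by rewrite Num.Theory.pnatr_eq0.
split.
  apply: (mulfI two0); rewrite mulr0 -[RHS](addr0 0) -{1}Dp -Dm; ring.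
apply: (mulfI (mulf_neq0 two0 ls0)); rewrite mulr0 -[RHS](subr0 0) -{1}Dp -Dm; ring.
Qed.

(** The gradient of [g] in x is orthogonal to the tangent, and a radial relation ties its normal
    component to dg/dd; the two linear relations determine it. *)
Theorem offset_normal y1 y2 x1 x2 d : d != 0 -> offset_pair f y1 y2 x1 x2 d ->
  g^`M(i3_2).@[tri x1 x2 d] * (x1 - y1) = - (d * g^`M(ord0).@[tri x1 x2 d]) /\
  g^`M(i3_2).@[tri x1 x2 d] * (x2 - y2) = - (d * g^`M(i3_1).@[tri x1 x2 d]).
Proof.
move=> d0 [fy hy ny dy].
have param := @offset_pair_param y1 y2.
have tang := @tangential_vanishing _ _ irr_f deg_f ndh y1 y2.
move: ny; set f1 := f^`M(ord0).@[_]; set f2 := f^`M(i2_1).@[_] => ny.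
pose h := (norm_gradient f).@[duo y1 y2].
have hE : h = f1 ^+ 2 + f2 ^+ 2 by rewrite /h /norm_gradient mevalD !expr2 !mevalM.
have h0 : h != 0 := hy.
(* The coefficient of the projection of x - y onto the gradient; since x - y is normal, it equals l
   times the gradient. *)
pose l := (f1 * (x1 - y1) + f2 * (x2 - y2)) / h.
have lh : l * h = f1 * (x1 - y1) + f2 * (x2 - y2) by rewrite /l divfK.
have v1 : x1 = y1 + l * f1.
  apply: (mulfI h0); apply/eqP; rewrite -subr_eq0; apply/eqP.
  rewrite (_ : h * x1 - _ = h * (x1 - y1) - f1 * (l * h)); last by ring.
  rewrite lh hE (_ : _ - _ = f2 * (f2 * (x1 - y1) - f1 * (x2 - y2))); last by ring.
  by rewrite ny subrr mulr0.
have v2 : x2 = y2 + l * f2.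
  apply: (mulfI h0); apply/eqP; rewrite -subr_eq0; apply/eqP.
  rewrite (_ : h * x2 - _ = h * (x2 - y2) - f2 * (l * h)); last by ring.
  rewrite lh hE (_ : _ - _ = f1 * (f1 * (x2 - y2) - f2 * (x1 - y1))); last by ring.
  by rewrite ny subrr mulr0.
have dE : d ^+ 2 = l ^+ 2 * h by rewrite -dy v1 v2 hE; ring.
have l0 : l != 0.
  by apply: contraNneq d0 => l0; rewrite -sqrf_eq0 dE l0 expr0n mul0r.
(* The square root of h whose sign matches d. *)
pose delta := d / l; have dl : d = l * delta by rewrite /delta mulrC divfK.
have delta2 : delta ^+ 2 = h by rewrite /delta exprMn exprVn dE mulrAC divff ?mul1r // expf_neq0.
have delta0 : delta != 0 by apply: contraNneq h0 => e0; rewrite -delta2 e0 expr0n.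
have radial : g^`M(ord0).@[tri x1 x2 d] * f1 + g^`M(i3_1).@[tri x1 x2 d] * f2 +
    g^`M(i3_2).@[tri x1 x2 d] * delta = 0.
  pose P := tri (y1%:P + f1 *: 'X) (y2%:P + f2 *: 'X) (delta *: 'X).
  have Px x : (fun i => (P i).[x]) =1 tri (y1 + x * f1) (y2 + x * f2) (x * delta).
    by apply: I3P; rewrite /P /tri /= ?(hornerD, hornerC, hornerZ, hornerX) mulrC.
  have P0 : along P g = 0.
    apply: poly_eq0_punctured => x x0; rewrite alongE (meval_eq _ (Px x)).
    by apply: van_g (param x delta fy hy delta2); rewrite mulf_neq0.
  have := horner_deriv_along P g l.
  rewrite P0 deriv0 horner0 sum_I3 !(meval_eq _ (Px l)) -v1 -v2 -dl => ->.
  by rewrite /P /tri /= !derivD !derivC !derivZ !derivX !add0r !hornerZ !hornerC !mulr1.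
have [E [O split]] := even_odd_split g.
have van := van_even_odd split.
have gEO := even_odd_split_deriv split.
have tangential : f2 * g^`M(ord0).@[tri x1 x2 d] = f1 * g^`M(i3_1).@[tri x1 x2 d].
  rewrite !gEO // dE.
  have DE := tang f1 f2 h fy erefl erefl erefl h0 E
    (fun a b m fa ha m0 => (van a b m fa ha m0).1) l l0.
  have DO := tang f1 f2 h fy erefl erefl erefl h0 O
    (fun a b m fa ha m0 => (van a b m fa ha m0).2) l l0.
  apply/eqP; rewrite -subr_eq0; apply/eqP.
  rewrite -[RHS]oppr0 -[in RHS](addr0 0) -[in X in - (X + _)]DE -(mulr0 d) -DO -v1 -v2; ring.
set g1 := (g^`M(ord0)).@[_] in radial tangential *.
set g2 := (g^`M(i3_1)).@[_] in radial tangential *.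
set g3 := (g^`M(i3_2)).@[_] in radial *.
(* The gradient of [g] in x is decomposed in the orthogonal basis formed by the normal and the
   tangent. *)
have hg1 : h * g1 = - (f1 * delta * g3).
  apply/eqP; rewrite -subr_eq0; apply/eqP; rewrite hE.
  rewrite (_ : _ - _ = f1 * (g1 * f1 + g2 * f2 + g3 * delta) + f2 * (f2 * g1 - f1 * g2)).
    by rewrite radial tangential subrr !mulr0 addr0.
  by ring.
have hg2 : h * g2 = - (f2 * delta * g3).
  apply/eqP; rewrite -subr_eq0; apply/eqP; rewrite hE.
  rewrite (_ : _ - _ = f2 * (g1 * f1 + g2 * f2 + g3 * delta) - f1 * (f2 * g1 - f1 * g2)).
    by rewrite radial tangential subrr !mulr0 subr0.
  by ring.
have w1 : x1 - y1 = l * f1 by rewrite v1; ring.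
have w2 : x2 - y2 = l * f2 by rewrite v2; ring.
rewrite w1 w2; split; apply: (mulfI h0).
  have -> : h * - (d * g1) = - (d * (h * g1)) by ring.
  rewrite hg1 dl -delta2; ring.
have -> : h * - (d * g2) = - (d * (h * g2)) by ring.
  rewrite hg2 dl -delta2; ring.
Qed.

End NormalVector.

(** * Generic fibres of the offset *)

Section GenericFibre.
Variables (F : numClosedFieldType) (f : {mpoly F[2]}) (g : {mpoly F[3]}).
Hypothesis irr_f : irreducible_mpoly f.
Hypothesis deg_f : (1 < size (poly2 f))%N.
Hypothesis ndh : ~ exists q, norm_gradient f = f * q.
Hypothesis ndf2 : ~ exists q, f^`M(i2_1) = f * q.
Hypothesis sep_g : separable_poly (poly3 g).
Hypothesis van_g : forall y1 y2 x1 x2 d,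
  offset_pair f y1 y2 x1 x2 d -> g.@[tri x1 x2 d] = 0.
Hypothesis closure_g : forall q : {mpoly F[3]},
  (forall y1 y2 x1 x2 d, offset_pair f y1 y2 x1 x2 d -> q.@[tri x1 x2 d] = 0) ->
  forall x1 x2 d, g.@[tri x1 x2 d] = 0 -> q.@[tri x1 x2 d] = 0.

Local Notation g1 x1 x2 d := (g^`M(ord0).@[tri x1 x2 d]).
Local Notation g2 x1 x2 d := (g^`M(i3_1).@[tri x1 x2 d]).
Local Notation g3 x1 x2 d := (g^`M(i3_2).@[tri x1 x2 d]).

(** Multiplying [q] by d makes it vanish at the pairs with d = 0 too. *)
Lemma closure_punctured (q : {mpoly F[3]}) :
  (forall y1 y2 x1 x2 d, d != 0 -> offset_pair f y1 y2 x1 x2 d -> q.@[tri x1 x2 d] = 0) ->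
  forall x1 x2 d, d != 0 -> g.@[tri x1 x2 d] = 0 -> q.@[tri x1 x2 d] = 0.
Proof.
move=> q0 x1 x2 d d0 gz; apply: (mulfI d0); rewrite mulr0.
have := closure_g (q := 'X_i3_2 * q) _ gz.
rewrite mevalM mevalXU; apply => y1 y2 a1 a2 b ab.
rewrite mevalM mevalXU /tri /=.
by case: (eqVneq b 0) => [->|b0]; rewrite ?mul0r // (q0 _ _ _ _ _ b0 ab) mulr0.
Qed.

(** Functions in the localization at dg/dd, described by their values where it is nonzero. *)
Definition regular_fun (phi : F -> F -> F -> F) := exists N (a : {mpoly F[3]}),
  forall x1 x2 d, g3 x1 x2 d != 0 -> a.@[tri x1 x2 d] = g3 x1 x2 d ^+ N * phi x1 x2 d.

Lemma regular_poly (a : {mpoly F[3]}) : regular_fun (fun x1 x2 d => a.@[tri x1 x2 d]).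
Proof. by exists 0%N, a => x1 x2 d _; rewrite mul1r. Qed.

Lemma regularD phi psi : regular_fun phi -> regular_fun psi ->
  regular_fun (fun x1 x2 d => phi x1 x2 d + psi x1 x2 d).
Proof.
move=> [N [a aE]] [M [b bE]].
exists (N + M)%N, (g^`M(i3_2) ^+ M * a + g^`M(i3_2) ^+ N * b) => x1 x2 d nz.
rewrite mevalD !mevalM !rmorphXn /= aE // bE // exprD; ring.
Qed.

Lemma regularM phi psi : regular_fun phi -> regular_fun psi ->
  regular_fun (fun x1 x2 d => phi x1 x2 d * psi x1 x2 d).
Proof.
move=> [N [a aE]] [M [b bE]]; exists (N + M)%N, (a * b) => x1 x2 d nz.
by rewrite mevalM aE // bE // exprD; ring.
Qed.

Lemma regularV : regular_fun (fun x1 x2 d => (g3 x1 x2 d)^-1).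
Proof. by exists 1%N, 1 => x1 x2 d nz; rewrite meval1 expr1 divff. Qed.

Lemma regular_comp phi psi (a : {mpoly F[2]}) : regular_fun phi -> regular_fun psi ->
  regular_fun (fun x1 x2 d => a.@[duo (phi x1 x2 d) (psi x1 x2 d)]).
Proof.
move=> rphi rpsi; elim/mpoly_ring_ind: a => [c||p q|p q].
- by exists 0%N, c%:MP => x1 x2 d _; rewrite !mevalC mul1r.
- apply: I2P; [case: rphi | case: rpsi] => N [a aE];
  by exists N, a => x1 x2 d nz; rewrite aE // mevalXU.
- move=> rp rq; have [N [a aE]] := regularD rp rq.
  by exists N, a => x1 x2 d nz; rewrite aE // mevalD.
move=> rp rq; have [N [a aE]] := regularM rp rq.
by exists N, a => x1 x2 d nz; rewrite aE // mevalM.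
Qed.

(** After denominators are cleared, one further factor dg/dd takes care of the pairs where it
    vanishes. *)
Lemma regular_closure phi : regular_fun phi ->
  (forall y1 y2 x1 x2 d, d != 0 -> g3 x1 x2 d != 0 ->
     offset_pair f y1 y2 x1 x2 d -> phi x1 x2 d = 0) ->
  forall x1 x2 d, d != 0 -> g3 x1 x2 d != 0 -> g.@[tri x1 x2 d] = 0 -> phi x1 x2 d = 0.
Proof.
move=> [N [a aE]] phi0 x1 x2 d d0 nz gz.
have := closure_punctured (q := g^`M(i3_2) * a) _ d0 gz.
rewrite mevalM aE // => H; apply/eqP.
have /eqP : g3 x1 x2 d * (g3 x1 x2 d ^+ N * phi x1 x2 d) = 0.
  apply: H => y1 y2 a1 a2 b b0 ab; rewrite mevalM.
  case: (eqVneq (g3 a1 a2 b) 0) => [->|nzb]; first by rewrite mul0r.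
  by rewrite aE // (phi0 _ _ _ _ _ b0 nzb ab) !mulr0.
by rewrite !mulf_eq0 expf_eq0 (negPf nz) andbF.
Qed.

(** The identity of [offset_normal] solved for y: the candidate foot on the curve of the normal
    through x. *)
Definition foot1 x1 x2 d := x1 + d * (g1 x1 x2 d * (g3 x1 x2 d)^-1).
Definition foot2 x1 x2 d := x2 + d * (g2 x1 x2 d * (g3 x1 x2 d)^-1).

Lemma regular_foot1 : regular_fun foot1.
Proof.
have [N [a aE]] := regularD (regular_poly 'X_ord0) (regularM (regular_poly 'X_i3_2)
  (regularM (regular_poly g^`M(ord0)) regularV)).
by exists N, a => x1 x2 d nz; rewrite aE // !mevalXU.
Qed.

Lemma regular_foot2 : regular_fun foot2.
Proof.
have [N [a aE]] := regularD (regular_poly 'X_i3_1) (regularM (regular_poly 'X_i3_2)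
  (regularM (regular_poly g^`M(i3_1)) regularV)).
by exists N, a => x1 x2 d nz; rewrite aE // !mevalXU.
Qed.

Let normal := @offset_normal F f irr_f deg_f ndh g (fun y1 y2 x1 x2 d _ => @van_g y1 y2 x1 x2 d).

Lemma footE y1 y2 x1 x2 d : d != 0 -> g3 x1 x2 d != 0 ->
  offset_pair f y1 y2 x1 x2 d -> foot1 x1 x2 d = y1 /\ foot2 x1 x2 d = y2.
Proof.
move=> d0 nz /(normal d0) [E1 E2]; rewrite /foot1 /foot2.
by split; apply: (mulfI nz); rewrite mulrDr mulrCA [g3 _ _ _ * (_ * _)]mulrC divfK //;
  [rewrite -[d * _]opprK -E1 | rewrite -[d * _]opprK -E2]; ring.
Qed.

Lemma offset_pair_simple y1 y2 x1 x2 d : d != 0 -> offset_pair f y1 y2 x1 x2 d ->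
  g3 x1 x2 d = 0 -> g1 x1 x2 d = 0.
Proof.
move=> d0 /(normal d0) [E1 _] z3; move/eqP: E1.
by rewrite z3 mul0r eq_sym oppr_eq0 mulf_eq0 (negPf d0) => /eqP.
Qed.

(** Each equation of an offset pair, written at the foot, is a regular function vanishing on offset
    pairs, so it extends to the zeros of [g]. The inequality on the gradient does not extend in this
    way and is assumed. *)
Lemma foot_offset_pair x1 x2 d : d != 0 -> g3 x1 x2 d != 0 -> g.@[tri x1 x2 d] = 0 ->
  (norm_gradient f).@[duo (foot1 x1 x2 d) (foot2 x1 x2 d)] != 0 ->
  offset_pair f (foot1 x1 x2 d) (foot2 x1 x2 d) x1 x2 d.
Proof.
have rf1 := regular_foot1; have rf2 := regular_foot2.
have rN1 := regular_poly (- 1); have rX1 := regular_poly 'X_ord0.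
have rX2 := regular_poly 'X_i3_1; have rX3 := regular_poly 'X_i3_2.
have rv1 := regularD rX1 (regularM rN1 rf1).
have rv2 := regularD rX2 (regularM rN1 rf2).
move=> d0 nz gz hz; split=> //.
- apply: (regular_closure (regular_comp f rf1 rf2)) => // y1 y2 a1 a2 b b0 nzb ab.
  by have [-> ->] := footE b0 nzb ab; case: ab.
- apply/eqP; rewrite -subr_eq0; apply/eqP.
  have := regular_closure (regularD (regularM (regular_comp f^`M(i2_1) rf1 rf2) rv1)
    (regularM rN1 (regularM (regular_comp f^`M(ord0) rf1 rf2) rv2))) _ d0 nz gz.
  rewrite !mevalN !meval1 !mevalXU !mulN1r; apply => y1 y2 a1 a2 b b0 nzb ab.
  rewrite !mevalN !meval1 !mevalXU !mulN1r.
  by have [-> ->] := footE b0 nzb ab; case: ab => _ _ n _; rewrite /tri /= n subrr.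
apply/eqP; rewrite -subr_eq0; apply/eqP.
have := regular_closure (regularD (regularD (regularM rv1 rv1) (regularM rv2 rv2))
    (regularM rN1 (regularM rX3 rX3))) _ d0 nz gz.
rewrite !mevalN !meval1 !mevalXU !mulN1r !expr2; apply => y1 y2 a1 a2 b b0 nzb ab.
rewrite !mevalN !meval1 !mevalXU !mulN1r -!expr2.
by have [-> ->] := footE b0 nzb ab; case: ab => _ _ _ n; rewrite /tri /= n subrr.
Qed.

Lemma eval3_deriv x k d : eval3 x k d (poly3 g)^`() = g1 x k d.
Proof.
pose P : 'I_3 -> {poly F} := tri 'X k%:P d%:P.
have Px c : (fun i => (P i).[c]) =1 tri c k d.
  by apply: I3P; rewrite /P /tri /= ?hornerC ?hornerX.
have D : map_poly (eval2 k d) (poly3 g) = along P g.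
  by apply: poly_eq_ext => c; rewrite alongE (meval_eq _ (Px c)) -eval3_poly3.
have -> : eval3 x k d (poly3 g)^`() = ((along P g)^`()).[x] by rewrite -D deriv_map.
rewrite horner_deriv_along (bigD1 ord0) //= big1 ?addr0 => [|i i0].
  by rewrite (meval_eq _ (Px x)) /P /tri /= derivX hornerC mulr1.
suff -> : (P i)^`() = 0 by rewrite horner0 mulr0.
by move: i i0; apply: I3P => //; rewrite /P /tri /= derivC.
Qed.

Lemma eval3_root (p : {poly {poly {poly F}}}) k d : (1 < size p)%N ->
  eval2 k d (lead_coef p) != 0 -> exists x, eval3 x k d p = 0.
Proof.
move=> sp lp; have /closed_rootP [x /rootP px] : size (map_poly (eval2 k d) p) != 1%N.
  by rewrite size_map_poly_id0 // neq_ltn sp orbT.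
by exists x.
Qed.

Lemma eval3C x k d (c : {poly {poly F}}) : eval3 x k d c%:P = eval2 k d c.
Proof. exact: evalmC. Qed.

(* If G and e had a common factor p, with c1 G = q p, then c1 c2 q p' would
   vanish on the offset pairs, hence on G = 0, hence at the roots of p;
   but a root of both p and q p' is a double root of G. *)
Lemma coprime_offset_equation (e : {mpoly F[3]}) :
  (forall y1 y2 x1 x2 d, d != 0 -> offset_pair f y1 y2 x1 x2 d ->
     e.@[tri x1 x2 d] = 0 -> g1 x1 x2 d = 0) ->
  coprimep (poly3 g) (poly3 e).
Proof.
move=> eP; rewrite coprimep_def; apply/negPn/negP.
have g0 := separable_poly_neq0 sep_g.
have [U [V [r [r0 bez]]]] : exists U V r, r != 0 /\
    U * poly3 g + V * (poly3 g)^`() = r%:P.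
  by apply: bezout_scalar; move: sep_g; rewrite unlock.
set p := gcdp _ _ => sp.
have p0 : p != 0 by rewrite gcdp_eq0 (negPf g0).
have [c1 [q [c10 Dg]]] : exists c q, c != 0 /\ c *: poly3 g = q * p.
  have /Pdiv.Idomain.dvdpP [[c q] c0 D] : p %| poly3 g by apply: dvdp_gcdl.
  by exists c, q.
have [c2 [s [c20 De]]] : exists c q, c != 0 /\ c *: poly3 e = q * p.
  have /Pdiv.Idomain.dvdpP [[c s] c0 D] : p %| poly3 e by apply: dvdp_gcdr.
  by exists c, s.
have {}sp : (1 < size p)%N by rewrite ltn_neqAle eq_sym sp size_poly_gt0.
have Dg' : c1 *: (poly3 g)^`() = q^`() * p + q * p^`().
  by rewrite -derivZ Dg derivM.
have evg x k d : eval2 k d c1 * g.@[tri x k d] = eval3 x k d q * eval3 x k d p.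
  by rewrite -rmorphM -Dg -mul_polyC rmorphM /= eval3C eval3_poly3.
have eve x k d : eval2 k d c2 * e.@[tri x k d] = eval3 x k d s * eval3 x k d p.
  by rewrite -rmorphM -De -mul_polyC rmorphM /= eval3C eval3_poly3.
have evg' x k d : eval2 k d c1 * g1 x k d =
    eval3 x k d q^`() * eval3 x k d p + eval3 x k d q * eval3 x k d p^`().
  by rewrite -!rmorphM -rmorphD -Dg' -mul_polyC rmorphM /= eval3C eval3_deriv.
(* The factor c1 c2 makes [W] vanish wherever one of these scalars cannot be cancelled. *)
pose W := mpoly3 ((c1 * c2)%:P * (q * p^`())).
have WE x k d : W.@[tri x k d] = eval2 k d c1 * eval2 k d c2 *
    (eval3 x k d q * eval3 x k d p^`()).
  by rewrite meval_mpoly3 rmorphM eval3C !rmorphM.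
have W0 : forall x k d, d != 0 -> g.@[tri x k d] = 0 -> W.@[tri x k d] = 0.
  apply: closure_punctured => y1 y2 x k d d0 ab.
  have gz := van_g ab; rewrite WE.
  case: (eqVneq (eval2 k d c1) 0) => [->|c1z]; first by rewrite !mul0r.
  case: (eqVneq (eval2 k d c2) 0) => [->|c2z]; first by rewrite mulr0 mul0r.
  case: (eqVneq (eval3 x k d p) 0) => [pz|pz].
    have ez : e.@[tri x k d] = 0 by apply: (mulfI c2z); rewrite eve pz !mulr0.
    have := evg' x k d; rewrite (eP _ _ _ _ _ d0 ab ez) pz !mulr0 add0r => <-.
    by rewrite mulr0.
  have /eqP := evg x k d; rewrite gz mulr0 eq_sym mulf_eq0 (negPf pz) orbF => /eqP ->.
  by rewrite mul0r mulr0.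
have H0 : r * (c1 * c2) * lead_coef p * 'X%:P != 0.
  by rewrite !mulf_neq0 // ?lead_coef_eq0 // polyC_eq0 polyX_eq0.
have [k [d]] := eval2_nonzero H0.
rewrite !rmorphM /= !mulf_eq0 !negb_or => /andP[/andP[/andP[rz /andP[c1z c2z]] lz]].
rewrite evalmC evalmX => d0.
have [x px] := eval3_root sp lz.
have gz : g.@[tri x k d] = 0 by apply: (mulfI c1z); rewrite evg px !mulr0.
have /eqP := W0 _ _ _ d0 gz; rewrite WE !mulf_eq0 (negPf c1z) (negPf c2z) /= => qp.
(* At x both [p] and q p' vanish, so [g] and its x1-derivative do, which contradicts the
   nonvanishing of [r]. *)
case/negP: rz; have := congr1 (eval3 x k d) bez.
rewrite eval3C rmorphD !rmorphM /= eval3_poly3 gz mulr0 add0r eval3_deriv => <-.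
rewrite (_ : g1 x k d = 0) ?mulr0 //.
by apply: (mulfI c1z); rewrite evg' px !mulr0 add0r; apply/eqP; rewrite mulf_eq0.
Qed.

Theorem generic_fibre : exists2 H : {poly {poly F}}, H != 0 &
  forall k d, eval2 k d H != 0 ->
  [/\ d != 0, forall y1 y2, f.@[duo y1 y2] = 0 -> f^`M(i2_1).@[duo y1 y2] = 0 -> y2 <> k &
    exists xs : seq F, [/\ uniq xs, size xs = (size (poly3 g)).-1,
      forall x, (x \in xs) = (g.@[tri x k d] == 0) &
      forall x, x \in xs -> g3 x k d != 0 /\
        offset_pair f (foot1 x k d) (foot2 x k d) x k d]].
Proof.
have g0 := separable_poly_neq0 sep_g.
have [U [V [r [r0 bez]]]] : exists U V r, r != 0 /\
    U * poly3 g + V * (poly3 g)^`() = r%:P.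
  by apply: bezout_scalar; move: sep_g; rewrite unlock.
have [N [a aE]] := regular_comp (norm_gradient f) regular_foot1 regular_foot2.
(* [e] is dg/dd times a numerator of the squared gradient norm at the foot; its zeros are the points
   that [foot_offset_pair] does not cover. *)
have [e eE cop_e] : exists2 e : {mpoly F[3]},
    forall x k d, e.@[tri x k d] = g3 x k d * a.@[tri x k d] &
    coprimep (poly3 g) (poly3 e).
  exists (g^`M(i3_2) * a) => [x k d|]; first by rewrite mevalM.
  apply: coprime_offset_equation => y1 y2 x1 x2 d d0 ab.
  rewrite mevalM; case: (eqVneq (g3 x1 x2 d) 0) => [z3 _|nz].
    exact: offset_pair_simple ab z3.
  move/eqP; rewrite aE // !mulf_eq0 expf_eq0 (negPf nz) andbF /=.
  by have [-> ->] := footE d0 nz ab; case: ab => _ /negPf ->.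
have [U2 [V2 [r2 [r20 bez2]]]] := bezout_scalar cop_e.
have [r3 r30 r3P] := common_zeros_finite irr_f deg_f ndf2.
pose r3k := map_poly polyC r3.
have r3k0 : r3k != 0 by rewrite map_polyC_eq0.
(* The factors, in order, keep the roots simple, keep [e] nonzero at them, preserve the degree in
   x1, avoid the heights of ramification points, and exclude d = 0. The outer variable is k and the
   inner one d. *)
exists (r * r2 * lead_coef (poly3 g) * r3k * 'X%:P).
  by rewrite !mulf_neq0 // ?lead_coef_eq0 // polyC_eq0 polyX_eq0.
move=> k d; rewrite !rmorphM /= !mulf_eq0 !negb_or.
move=> /andP[/andP[/andP[/andP[rz r2z] lz] r3z]].
rewrite evalmC evalmX => d0.
have {}r3z : r3.[k] != 0.
  apply: contraNneq r3z => r3z; rewrite eval2E /r3k.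
  by rewrite (horner_map (@polyC F)) r3z hornerC.
split=> // [y1 y2 fy f2y y2k|].
  by case/eqP: r3z; rewrite -y2k; apply: (r3P y1).
pose p := map_poly (eval2 k d) (poly3 g).
have pE x : p.[x] = g.@[tri x k d] by rewrite -eval3_poly3.
have sp : size p = size (poly3 g) by rewrite size_map_poly_id0.
have sep_p : separable_poly p.
  rewrite unlock; apply/Pdiv.ClosedField.coprimepP => x /rootP px.
  rewrite deriv_map; apply: contraNneq rz => p'x.
  have := congr1 (eval3 x k d) bez; rewrite eval3C rmorphD !rmorphM /= => <-.
  by rewrite [X in _ + _ * X]p'x eval3_poly3 -pE px !mulr0 addr0.
have p0 : p != 0 by apply: separable_poly_neq0.
have [xs Dp] := closed_field_poly_normal p.
have lp0 : lead_coef p != 0 by rewrite lead_coef_eq0.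
have xsE x : (x \in xs) = (g.@[tri x k d] == 0).
  by rewrite -pE -rootE Dp rootZ // root_prod_XsubC.
exists xs; split=> //.
- rewrite -separable_prod_XsubC; apply: dvdp_separable sep_p.
  by rewrite Dp dvdpZr.
- by rewrite -sp Dp size_scale // size_prod_XsubC.
move=> x; rewrite xsE => /eqP gz.
have ez : e.@[tri x k d] != 0.
  apply: contraNneq r2z => ez; have := congr1 (eval3 x k d) bez2.
  by rewrite eval3C rmorphD !rmorphM /= !eval3_poly3 gz ez !mulr0 addr0 => <-.
have nz : g3 x k d != 0 by apply: contraNneq ez => z3; rewrite eE z3 mul0r.
split=> //; apply: foot_offset_pair => //.
by apply: contraNneq ez => hz; rewrite eE aE // hz !mulr0.
Qed.

End GenericFibre.

(** * Square-free equations, lines and ramification *)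

Section Reduction.
Variable F : numClosedFieldType.

Lemma deriv_eq0 (p : {poly F}) : p^`() = 0 -> (size p <= 1)%N.
Proof.
move=> dp; apply/leq_sizeP => -[//|i] _; apply/eqP.
have /eqP := congr1 (fun q : {poly F} => q`_i) dp.
by rewrite coef_deriv coef0 Num.Theory.mulrn_eq0.
Qed.

(** A repeated factor over the field of fractions in (x2, d) descends, by Gauss's lemma applied once
    per copy, to a square dividing [g]; characteristic zero gives the condition on derivatives. *)
Lemma separable_of_squarefree (g : {mpoly F[3]}) :
  (forall h q, g = h * h * q -> exists c, h = c%:MP) -> separable_poly (poly3 g).
Proof.
move=> sqf.
have g0 : poly3 g != 0.
  (* The zero polynomial is a multiple of the square of x1, so it is not square-free. *)
  apply/eqP => g0; have g00 : g = 0 by rewrite -[g]poly3K g0 rmorph0.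
  case: (sqf 'X_ord0 0) => [|c Xc]; first by rewrite mulr0.
  have := congr1 (meval (fun _ => c + 1)) Xc; rewrite mevalXU mevalC => /eqP.
  by rewrite -subr_eq0 addrAC subrr add0r oner_eq0.
have facA : factorial_ring {poly {poly F}}.
  by apply/factorial_poly/factorial_poly/factorial_field.
apply/separable_polyP; split=> [u v uv|u _ su]; last first.
  apply/eqP => du; move: su; rewrite ltnNge; case/negP.
  apply/leq_sizeP => -[//|i] _; apply/eqP.
  have /eqP := congr1 (fun q : {poly {poly {poly F}}} => q`_i) du.
  rewrite coef_deriv coef0 -mulr_natr mulf_eq0 => /orP[//|].
  by rewrite -!polyC_natr !polyC_eq0 Num.Theory.pnatr_eq0.
rewrite coprimep_def; apply/negPn/negP; set e := gcdp u v => se.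
have [c [s [c0 Dg]]] : exists c q, c != 0 /\ c *: poly3 g = q * (e * e).
  have /Pdiv.Idomain.dvdpP [[c q] c0 D] : e * e %| poly3 g.
    by apply: dvdp_trans uv; rewrite dvdp_mul ?dvdp_gcdl ?dvdp_gcdr.
  by exists c, q.
rewrite mulrA [s * e]mulrC -mulrA in Dg.
have [al [be [e1 [w [De Dse Dg1]]]]] := gauss_split (facA _ c0) Dg.
have be0 : be != 0.
  apply/eqP => be0; have /eqP := Dg; rewrite Dse be0 scale0r mulr0.
  by rewrite -mul_polyC mulf_eq0 polyC_eq0 (negPf c0) (negPf g0).
have Dw : be *: w = e1 * (al *: s) by rewrite -Dse {1}De mulrC -scalerAr -scalerAl.
have [al2 [be2 [e2 [s2 [De1 _ Dw1]]]]] := gauss_split (facA _ be0) Dw.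
have Dg2 : poly3 g = e2 * e2 * (al2 *: s2).
  by rewrite Dg1 De1 Dw1 -scalerAl -scalerAr mulrA.
have al20 : al2 != 0.
  by apply: contraNneq g0 => a0; rewrite Dg2 a0 scale0r mulr0.
have al0 : al != 0.
  apply/eqP => a0; have /eqP := Dg; rewrite De a0 scale0r mul0r.
  by rewrite -mul_polyC mulf_eq0 polyC_eq0 (negPf c0) (negPf g0).
have := sqf (mpoly3 e2) (mpoly3 (al2 *: s2)); rewrite -!rmorphM -Dg2 poly3K.
case=> // b /mpoly3_const De2; case/negP: se.
rewrite De De1 !size_scale // De2 size_polyC.
case: (eqVneq b%:P%:P 0) => // b0.
by move: g0; rewrite Dg2 De2 b0 polyC0 !mul0r eqxx.
Qed.

Lemma meval_evalm n (i : 'I_n) (c : {poly F}) v :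
  (evalm (@mpolyC n F) 'X_i c).@[v] = c.[v i].
Proof.
apply: (poly_rmorph_ext (phi := meval v \o evalm (@mpolyC n F) 'X_i)
          (psi := horner_eval (v i))) => [b|] /=.
  by rewrite evalmC mevalC /horner_eval hornerC.
by rewrite evalmX mevalXU /horner_eval hornerX.
Qed.

Lemma meval_evalm2 n (i j : 'I_n) (H : {poly {poly F}}) v :
  (evalm (evalm (@mpolyC n F) 'X_j) 'X_i H).@[v] = eval2 (v i) (v j) H.
Proof.
apply: (poly_rmorph_ext (phi := meval v \o evalm (evalm (@mpolyC n F) 'X_j) 'X_i)
          (psi := eval2 (v i) (v j))) => [c|] /=.
  by rewrite !evalmC meval_evalm /= /horner_morph map_poly_id.
by rewrite !evalmX mevalXU.
Qed.

Variable f : {mpoly F[2]}.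
Hypothesis irr_f : irreducible_mpoly f.

(** Over an algebraically closed field, an irreducible polynomial in a single variable is linear. *)
Lemma line_of_univariate i (c : {poly F}) :
  (forall a b, f.@[duo a b] = c.[duo a b i]) ->
  exists r, forall a b, f.@[duo a b] = 0 <-> duo a b i = r.
Proof.
move=> fE; pose psi := evalm (@mpolyC 2 F) 'X_i.
have Df : f = psi c by apply: mpoly2_ext => a b; rewrite fE meval_evalm.
have const_psi p e : psi p = e%:MP -> p = e%:P.
  move=> De; apply: poly_eq_ext => x.
  by have := congr1 (meval (fun=> x)) De; rewrite meval_evalm mevalC hornerC.
have /closed_rootP [r /factor_theorem [q Dc]] : size c != 1%N.
  apply/negP => /size_poly1P [e _ De].
  by case: irr_f => /(_ e); rewrite Df De /psi evalmC.
have [_ /(_ (psi q) (psi ('X - r%:P)))] := irr_f.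
rewrite -rmorphM -Dc -Df => /(_ erefl) [] [e /const_psi De]; last first.
  by have := size_XsubC r; rewrite De size_polyC; case: eqP.
have e0 : e != 0.
  apply: contra_not_neq (irr_f.1 0) => e0.
  by rewrite Df Dc De e0 polyC0 mul0r rmorph0 mpolyC0.
exists r => a b; rewrite fE Dc De hornerM hornerC hornerXsubC.
split=> [/eqP|->]; last by rewrite subrr mulr0.
by rewrite mulf_eq0 (negPf e0) subr_eq0 => /eqP.
Qed.

Lemma horizontal_line : (size (poly2 f) <= 1)%N ->
  exists r, forall a b, f.@[duo a b] = 0 <-> b = r.
Proof.
move=> /size1_polyC Df; apply: (line_of_univariate (i := i2_1) (c := (poly2 f)`_0)).
by move=> a b; rewrite -eval2_poly2 Df eval2E hornerC coefC.
Qed.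

(** On each vertical line the restriction of [f] divides its own derivative; by degree the
    derivative is zero, so [f] depends on y1 only. *)
Lemma vertical_line : (exists q, f^`M(i2_1) = f * q) ->
  exists r, forall a b, f.@[duo a b] = 0 <-> a = r.
Proof.
move=> [q Dq].
pose P a : 'I_2 -> {poly F} := duo a%:P 'X.
have Px a x : (fun i => (P a i).[x]) =1 duo a x.
  by apply: I2P; rewrite /P /duo /= ?hornerC ?hornerX.
have fE a x : f.@[duo a x] = (along (P a) f).[x] by rewrite alongE (meval_eq _ (Px a x)).
have cst a : (size (along (P a) f) <= 1)%N.
  apply: deriv_eq0; apply/eqP/negP => /negP nz.
  have D : (along (P a) f)^`() = along (P a) f * along (P a) q.
    rewrite deriv_along sum_I2 /P /duo /= derivC derivX mulr0 add0r mulr1.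
    by rewrite Dq rmorphM.
  have fP0 : along (P a) f != 0 by apply: contraNneq nz => ->; rewrite deriv0.
  have := lt_size_deriv fP0; rewrite ltnNge D dvdp_leq //; last exact: dvdp_mulr.
  by rewrite -D.
apply: (line_of_univariate (i := ord0) (c := along (duo 'X 0) f)) => a b.
rewrite fE (size1_polyC (cst a)) hornerC -horner_coef0 -fE /= alongE.
by apply: meval_eq; apply: I2P; rewrite /duo /= ?hornerX ?horner0.
Qed.

(** The normal at such a point is horizontal. *)
Lemma offset_pair_ramified y1 y2 x1 x2 d : offset_pair f y1 y2 x1 x2 d ->
  f^`M(i2_1).@[duo y1 y2] = 0 -> y2 = x2.
Proof.
move=> [_ hy ny _] f2y; move: hy ny.
rewrite /norm_gradient mevalD !expr2 !mevalM f2y mulr0 addr0 mulf_eq0 orbb mul0r.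
move=> f1y /esym/eqP; rewrite mulf_eq0 (negPf f1y) subr_eq0 => /eqP ->.
by [].
Qed.

(** A normal that is not horizontal meets each horizontal line in one point. *)
Lemma offset_pair_inj y1 y2 x1 x1' x2 d d' : f^`M(i2_1).@[duo y1 y2] != 0 ->
  offset_pair f y1 y2 x1 x2 d -> offset_pair f y1 y2 x1' x2 d' -> x1 = x1'.
Proof.
move=> f2y [_ _ n _] [_ _ n' _]; apply: (addIr (- y1)); apply: (mulfI f2y).
by rewrite n n'.
Qed.

End Reduction.

(** * The system over the complex numbers *)

Lemma offset_pair_in_Omega (f : {mpoly CC[2]}) (y x : CC * CC) (d u : CC) :
  in_Omega f y x d u <->
  offset_pair f y.1 y.2 x.1 x.2 d /\ u = ((norm_gradient f).@[duo y.1 y.2])^-1.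
Proof.
have hE : (norm_gradient f).@[duo y.1 y.2] = ev (fd1 f) y ^+ 2 + ev (fd2 f) y ^+ 2.
  by rewrite /norm_gradient mevalD !expr2 !mevalM.
split=> [[fy by_ ny wy]|[[fy hy ny dy] ->]].
  have wh : u * (norm_gradient f).@[duo y.1 y.2] = 1.
    by rewrite hE; apply/eqP; rewrite -subr_eq0; apply/eqP.
  have hy : (norm_gradient f).@[duo y.1 y.2] != 0.
    by apply: contra_eq_neq wh => ->; rewrite mulr0 eq_sym oner_eq0.
  split; last by apply: (mulIf hy); rewrite wh mulVf.
  split=> //.
    move/eqP: ny; rewrite /nval mulNr addrC subr_eq0 => /eqP ny.
    exact: (esym ny).
  by apply/eqP; rewrite -subr_eq0; apply/eqP.
split=> //.
- by rewrite /bval dy subrr.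
- rewrite /nval mulNr; apply/eqP; rewrite addrC subr_eq0; apply/eqP; exact: (esym ny).
by rewrite /wval -hE mulVf // subrr.
Qed.

Theorem mainTheorem3 (f : {mpoly CC[2]}) (g : {mpoly CC[3]}) :
  mirreducible f -> not_a_line f -> ~ f_divides_f1f2 f ->
  generic_offset_equation f g ->
  exists Delta : CC * CC -> Prop,
    [/\ zariski_open2 Delta, (exists dk, Delta dk) &
    forall d0 k0 : CC, Delta (d0, k0) ->
      (exists (p q : 'I_(deg_x1 g) -> CC * CC) (u : 'I_(deg_x1 g) -> CC),
        [/\ forall (y x : CC * CC) (v : CC),
              S2sol f d0 k0 y x v <-> exists i, (y, x, v) = (p i, q i, u i),
            injective q,
            forall x : CC * CC, (x.2 = k0 /\ offset f d0 x) <-> exists i, x = q i,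
            injective p &
            forall i, regular_point f (p i) /\ ~ ramification_point f (p i)])
      /\ (forall y : CC * CC, ev f y = 0 -> y.2 = k0 -> ~ ramification_point f y)].
Proof.
move=> [ncst irr] nline ndh [closureP sqf _].
have irr_f : irreducible_mpoly f by split=> // c Df; apply: ncst; exists c.
have deg_f : (1 < size (poly2 f))%N.
  rewrite ltnNge; apply/negP => /(horizontal_line irr_f) [r rP].
  apply: nline; exists 0, 1, (- r); split; first by rewrite xpair_eqE oner_eq0 andbF.
  move=> y; rewrite mul0r mul1r add0r; split=> [/rP -> //|/eqP]; first by rewrite subrr.
  by rewrite subr_eq0 => /eqP; apply: (rP y.1 y.2).2.
have ndf2 : ~ exists q, f^`M(i2_1) = f * q.
  move=> /(vertical_line irr_f) [r rP].
  apply: nline; exists 1, 0, (- r); split; first by rewrite xpair_eqE oner_eq0.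
  move=> y; rewrite mul0r mul1r addr0; split=> [/rP -> //|/eqP]; first by rewrite subrr.
  by rewrite subr_eq0 => /eqP; apply: (rP y.1 y.2).2.
have sep_g := separable_of_squarefree sqf.
have van_g y1 y2 x1 x2 d : offset_pair f y1 y2 x1 x2 d -> g.@[tri x1 x2 d] = 0.
  move=> ab; apply/closureP => h; apply.
  exists (y1, y2), ((norm_gradient f).@[duo y1 y2])^-1.
  exact/offset_pair_in_Omega.
have closure_g (q : {mpoly CC[3]}) :
  (forall y1 y2 x1 x2 d, offset_pair f y1 y2 x1 x2 d -> q.@[tri x1 x2 d] = 0) ->
  forall x1 x2 d, g.@[tri x1 x2 d] = 0 -> q.@[tri x1 x2 d] = 0.
  move=> q0 x1 x2 d /closureP; apply=> s [y [u /offset_pair_in_Omega [ab _]]].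
  by rewrite (meval_eq _ (tri_eta s)); apply: q0 ab.
have [H H0 HP] := generic_fibre irr_f deg_f ndh ndf2 sep_g van_g closure_g.
(* The order of the variables is swapped: the open set has coordinates (d, k), while k is the outer
   variable of [H]. *)
pose Hm := evalm (evalm (@mpolyC 2 CC) 'X_ord0) 'X_i2_1 H.
have HmE d k : Hm.@[pt2 d k] = eval2 k d H by rewrite meval_evalm2.
exists (fun dk => eval2 dk.2 dk.1 H <> 0); split.
- exists (fun h => h = Hm) => -[d k]; rewrite /= -HmE.
  by split=> [nz|[h [-> //]]]; exists Hm.
- by have [k [d /eqP nz]] := eval2_nonzero H0; exists (d, k).
move=> d k /eqP /HP [d0 ram [xs [us sxs xsE xsP]]].
split; last by move=> [y1 y2] fy /= y2k [_ f2y]; apply: (ram y1 y2).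
have size_xs : size xs = deg_x1 g.
  have g0 : g != 0 by apply: contraTneq sep_g => ->; rewrite rmorph0 unlock coprime0p deriv0 eqp01.
  by rewrite sxs size_poly3.
pose x i := nth 0 xs i.
have xsI (i : 'I_(deg_x1 g)) : x i \in xs by rewrite mem_nth ?size_xs.
pose p (i : 'I_(deg_x1 g)) := (foot1 g (x i) k d, foot2 g (x i) k d).
pose q (i : 'I_(deg_x1 g)) := (x i, k).
pose u (i : 'I_(deg_x1 g)) := ((norm_gradient f).@[duo (p i).1 (p i).2])^-1.
have pair_pq i : offset_pair f (p i).1 (p i).2 (q i).1 (q i).2 d := (xsP _ (xsI i)).2.
have xs_index a : g.@[tri a k d] = 0 -> exists i : 'I_(deg_x1 g), a = x i.
  move/eqP; rewrite -xsE => axs; have lt_a : (index a xs < deg_x1 g)%N.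
    by rewrite -size_xs index_mem.
  by exists (Ordinal lt_a); rewrite /x /= nth_index.
have q_inj : injective q.
  move=> i j [] /eqP; rewrite nth_uniq ?size_xs // => /eqP ij; exact: val_inj.
(* With f2 = 0 the foot would lie at height k, where there are no ramification points. *)
have f2p i : f^`M(i2_1).@[duo (p i).1 (p i).2] != 0.
  apply/eqP => f2p; have [fy _ _ _] := pair_pq i.
  exact: ram fy f2p (offset_pair_ramified (pair_pq i) f2p).
exists p, q, u; split=> //.
- move=> y z v; split=> [[/offset_pair_in_Omega [ab Dv] /eqP]|[i [-> -> ->]]].
    rewrite subr_eq0 => /eqP zk; rewrite zk in ab.
    (* The first coordinate of a solution is a root of [g] at (k, d), and by [footE] it determines
       y. *)
    have [i Di] := xs_index _ (van_g _ _ _ _ _ ab); exists i.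
    have [y1E y2E] := footE irr_f deg_f ndh van_g d0 (xsP _ (xsI i)).1
      (eq_ind _ (fun a => offset_pair f y.1 y.2 a k d) ab _ Di).
    rewrite Dv /u /p /q /= y1E y2E -Di -zk.
    by case: (y) (z) => [? ?] [? ?].
  split; last by rewrite subrr.
  by apply/offset_pair_in_Omega.
- move=> z; split=> [[zk off]|[i ->]].
    have gz : g.@[tri z.1 k d] = 0.
      (* With d fixed, [g] vanishes on the projection of the pairs, hence on its Zariski closure. *)
      have := off (subst3 (tri 'X_ord0 'X_i2_1 d%:MP) g).
      have E v : (subst3 (tri 'X_ord0 'X_i2_1 d%:MP) g).@[v] = g.@[tri (v ord0) (v i2_1) d].
        rewrite meval_subst3; apply: meval_eq.
        by apply: I3P; rewrite /tri /= ?mevalXU ?mevalC.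
      rewrite E /pt2 /= zk; apply=> s [y [v /offset_pair_in_Omega [ab _]]].
      by rewrite E; apply: van_g ab.
    have [i Di] := xs_index _ gz; exists i; rewrite /q -Di -zk.
    by case: (z).
  (* Conversely, each [q i] lies in the projection itself, before taking the closure. *)
  split=> // h; apply; exists (p i), (u i).
  by apply/offset_pair_in_Omega.
- move=> i j pij; apply: q_inj; rewrite /q; congr (_, _).
  have pj := pair_pq j; rewrite -pij in pj.
  exact: offset_pair_inj (f2p i) (pair_pq i) pj.
move=> i; have [fy hy _ _] := pair_pq i; split.
  split=> // [[f1 f2]]; case/eqP: (f2p i); exact: f2.
by move=> [_ f2]; case/eqP: (f2p i).
Qed.
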